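(* Let $A$ be a higher Auslander algebra of global dimension $d$ and let $M$ be a finitely generated right $A$-module that is not projective-injective. Then (1) $\operatorname{pdim} M+\operatorname{domdim} M=\operatorname{gldim} A$; (2) $\operatorname{idim} M+\operatorname{codomdim} M=\operatorname{gldim} A$.
   Context: Algebras are finite-dimensional connected algebras over a field $K$; modules are finitely generated right modules unless stated otherwise; $D=\operatorname{Hom}_K(-,K)$. ''Projective-injective'' means both projective and injective. $\operatorname{pdim},\operatorname{idim},\operatorname{gldim}$ are projective, injective and global dimension. For a minimal injective coresolution $0\to M\to I^0\to I^1\to\cdots$, the dominant dimension $\operatorname{domdim} M$ is the smallest $n$ such that $I^n$ is not projective, and $\infty$ if there is none. Dually, $\operatorname{codomdim} M$ is the smallest $n$ such that the term $P_n$ of a minimal projective resolution $\cdots\to P_1\to P_0\to M\to 0$ is not injective, and $\infty$ if there is none. $\operatorname{domdim}A$ is the dominant dimension of the regular module. $A$ is a higher Auslander algebra if $\operatorname{gldim}A=\operatorname{domdim}A\ge 2$ (finite), or $A$ is semisimple. *)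

(* Defs.v *)
From HB Require Import structures.
From mathcomp Require Import all_boot all_order all_algebra all_field.
From mathcomp Require Import boolp constructive_ereal.

Set Implicit Arguments.
Unset Strict Implicit.
Unset Printing Implicit Defensive.

Import GRing.Theory.
Local Open Scope ring_scope.

(* Homological dimensions take their values in [\bar int]; only natural numbers
   and +oo occur, as values of the following "least n such that P n". *)
Definition least (P : nat -> Prop) : \bar int :=
  match pselect (exists n, `[< P n >]) with
  | left exP => (ex_minn exP)%:Z%:E
  | right _ => +oo%E
  end.

(* The definitions below are for left modules over an arbitrary ring R.  Right
   modules over A are left modules over the converse ring [A^c], so R is taken
   to be [A^c] in the end. *)
Section Modules.
Variable R : nzRingType.
Implicit Types M N L P I : lmodType R.

Definition fin_gen M : Prop :=
  exists (n : nat) (g : 'I_n -> M),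
    forall x : M, exists a : 'I_n -> R, x = \sum_i a i *: g i.

Definition zero_module M : Prop := forall x : M, x = 0.

Definition surj_map M N (f : {linear M -> N}) : Prop :=
  forall y, exists x, f x = y.

Definition exact_at M N L (f : {linear M -> N}) (g : {linear N -> L}) : Prop :=
  forall y, g y = 0 <-> exists x, f x = y.

(* Projectivity and injectivity are taken in the category of finitely generated
   modules. *)
Definition projective_module P : Prop :=
  forall (N L : lmodType R) (p : {linear N -> L}) (f : {linear P -> L}),
    fin_gen N -> fin_gen L -> surj_map p ->
    exists g : {linear P -> N}, forall x, p (g x) = f x.

Definition injective_module I : Prop :=
  forall (N L : lmodType R) (i : {linear N -> L}) (f : {linear N -> I}),
    fin_gen N -> fin_gen L -> injective i ->
    exists g : {linear L -> I}, forall x, g (i x) = f x.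

Definition essential_image M N (f : {linear M -> N}) : Prop :=
  forall U : {pred N}, submod_closed U ->
    (exists2 y, y \in U & y != 0) -> exists2 x, f x \in U & f x != 0.

Definition superfluous_kernel M N (f : {linear M -> N}) : Prop :=
  forall U : {pred M}, submod_closed U ->
    (forall x, exists u k, [/\ u \in U, f k = 0 & x = u + k]) ->
    forall x, x \in U.

Record coaugmented M := Coaugmented {
  cterm : nat -> lmodType R;
  caug : {linear M -> cterm 0};
  cdiff : forall n, {linear cterm n -> cterm n.+1} }.

Record augmented M := Augmented {
  aterm : nat -> lmodType R;
  aaug : {linear aterm 0 -> M};
  adiff : forall n, {linear aterm n.+1 -> aterm n} }.

Definition injective_coresolution M (C : coaugmented M) : Prop :=
  [/\ forall n, fin_gen (cterm C n) /\ injective_module (cterm C n),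
      injective (caug C),
      exact_at (caug C) (cdiff C 0)
    & forall n, exact_at (cdiff C n) (cdiff C n.+1)].

Definition projective_resolution M (C : augmented M) : Prop :=
  [/\ forall n, fin_gen (aterm C n) /\ projective_module (aterm C n),
      surj_map (aaug C),
      exact_at (adiff C 0) (aaug C)
    & forall n, exact_at (adiff C n.+1) (adiff C n)].

(* Each term is an injective envelope of the preceding cokernel. *)
Definition minimal_injective_coresolution M (C : coaugmented M) : Prop :=
  [/\ injective_coresolution C, essential_image (caug C)
    & forall n, essential_image (cdiff C n)].

(* Each term is a projective cover of the preceding kernel. *)
Definition minimal_projective_resolution M (C : augmented M) : Prop :=
  [/\ projective_resolution C, superfluous_kernel (aaug C)
    & forall n, superfluous_kernel (adiff C n)].

Definition pdim M : \bar int :=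
  least (fun n => exists C : augmented M, projective_resolution C /\
    forall k, (n < k)%N -> zero_module (aterm C k)).

Definition idim M : \bar int :=
  least (fun n => exists C : coaugmented M, injective_coresolution C /\
    forall k, (n < k)%N -> zero_module (cterm C k)).

(* Minimal (co)resolutions are unique up to isomorphism, so the choice of C
   is immaterial in the next two definitions. *)
Definition domdim M : \bar int :=
  least (fun n => exists C : coaugmented M,
    minimal_injective_coresolution C /\ ~ projective_module (cterm C n)).

Definition codomdim M : \bar int :=
  least (fun n => exists C : augmented M,
    minimal_projective_resolution C /\ ~ injective_module (aterm C n)).

(* The supremum of the projective dimensions, as the least upper bound. *)
Definition gldim : \bar int :=
  least (fun n => forall M, fin_gen M -> (pdim M <= n%:Z%:E)%E).

Definition simple_module M : Prop :=
  (exists x : M, x != 0) /\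
  forall U : {pred M}, submod_closed U ->
    (forall x, x \in U -> x = 0) \/ (forall x, x \in U).

(* M is isomorphic to the direct sum of finitely many simple modules S i. *)
Definition semisimple_module M : Prop :=
  exists (n : nat) (S : 'I_n -> lmodType R) (f : forall i, {linear S i -> M}),
    (forall i, simple_module (S i)) /\
    bijective (fun s : forall i, S i => \sum_i f i (s i)).

End Modules.

Section Algebras.
Variables (K : fieldType) (A : falgType K).

Definition connected_algebra : Prop :=
  forall e : A, e * e = e -> (forall x, e * x = x * e) -> e = 0 \/ e = 1.

Definition regular_module : lmodType A^c := (A^c)^o.

Definition semisimple_algebra : Prop := semisimple_module regular_module.

Definition higher_auslander_algebra : Prop :=
  [/\ gldim A^c = domdim regular_module, (2%:Z%:E <= gldim A^c)%E
    & (gldim A^c < +oo)%E] \/ semisimple_algebra.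

End Algebras.

(* Main.v *)
(* The finitely generated A-modules form an abelian category with finite lengths,
   enough projectives and enough injectives.  Write pd <= n, dd >= n, id <= n,
   cd >= n for the bounds on the projective, dominant, injective and codominant
   dimension, where dd >= n only asks for an exact sequence 0 -> M -> E^0 -> ...
   -> E^{n-1} with projective-injective terms; minimal coresolutions realize the
   largest such n.  Let d = gldim A = domdim A.

   If 0 -> X -> Y -> Z -> 0 is exact, dd X >= n+1 and dd Y >= n, then dd Z >= n.
   All projectives have dd >= d, so running along a projective resolution gives
   dd M >= d - p when pd M <= p.  If dd M >= d - p + 1, then M is a (d-p+1)-st
   syzygy, so pd M <= d forces pd M <= p - 1, or, for p = 0, forces M to be a direct
   summand of a projective-injective module.  This proves (1).

   Only two facts were used: pd <= d everywhere, and dd >= d on projectives.  Their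
   duals hold as well, so (2) is (1) in the opposite category: id <= d everywhere by
   dimension shifting of extensions, and cd I >= d for I injective because maps from
   a projective Q into the k-th syzygy X of I, k < d, extend from Q to its
   projective-injective envelope, so that X is a quotient of such an object. *)
Require Import Defs.
From HB Require Import structures.
From mathcomp Require Import all_boot all_order all_algebra all_field.
From mathcomp Require Import boolp constructive_ereal.
Set Implicit Arguments.
Unset Strict Implicit.
Unset Printing Implicit Defensive.
Import GRing.Theory.
Local Open Scope ring_scope.

(** * Abelian categories of finite length *)

Record precat := PreCat {
  ob : Type;
  hom : ob -> ob -> zmodType;
  comp : forall X Y Z, hom Y Z -> hom X Y -> hom X Z;
  idm : forall X, hom X X;
  compA : forall X Y Z W (f : hom Z W) (g : hom Y Z) (h : hom X Y),
    comp f (comp g h) = comp (comp f g) h;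
  comp1m : forall X Y (f : hom X Y), comp (idm Y) f = f;
  compm1 : forall X Y (f : hom X Y), comp f (idm X) = f;
  compDl : forall X Y Z (f g : hom Y Z) (h : hom X Y),
    comp (f + g) h = comp f h + comp g h;
  compDr : forall X Y Z (f : hom Y Z) (g h : hom X Y),
    comp f (g + h) = comp f g + comp f h }.

Notation "g ** f" := (comp g f) (at level 40, left associativity).

(** Only the arrows turn, so a dual notion is the original one taken at [opcat C], often by mere
    conversion. *)
Definition opcat (C : precat) : precat :=
  @PreCat (ob C) (fun X Y => hom Y X) (fun X Y Z g f => f ** g) (@idm C)
    (fun X Y Z W f g h => esym (compA h g f))
    (fun X Y f => compm1 f) (fun X Y f => comp1m f)
    (fun X Y Z f g h => compDr h f g) (fun X Y Z f g h => compDl g h f).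

Section Basic.
Variable C : precat.
Implicit Types X Y Z W : ob C.

Definition mono X Y (f : hom X Y) := forall W (g : hom W X), f ** g = 0 -> g = 0.
Definition epi X Y (f : hom X Y) := forall W (g : hom Y W), g ** f = 0 -> g = 0.

(** Both factorizations are unique because [i] is mono and [p] is epi. *)
Record ses X Y Z (i : hom X Y) (p : hom Y Z) : Prop := Ses {
  ses_mono : mono i;
  ses_epi : epi p;
  ses_comp : p ** i = 0;
  ses_ker : forall W (g : hom W Y), p ** g = 0 -> exists h, g = i ** h;
  ses_cok : forall W (g : hom Y W), g ** i = 0 -> exists h, g = h ** p }.

Definition short X Y Z := exists (i : hom X Y) (p : hom Y Z), ses i p.

Record biproduct X Y S (i1 : hom X S) (i2 : hom Y S) (p1 : hom S X) (p2 : hom S Y)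
    : Prop := Biproduct {
  bip11 : p1 ** i1 = idm X;
  bip22 : p2 ** i2 = idm Y;
  bip12 : p1 ** i2 = 0;
  bip21 : p2 ** i1 = 0;
  bipE : i1 ** p1 + i2 ** p2 = idm S }.

Definition proj P := forall N L (p : hom N L) (f : hom P L),
  epi p -> exists g, p ** g = f.
(* The binders are arranged so that [inj] is convertible to [proj] in [opcat]. *)
Definition inj I := forall N L (i : hom L N) (f : hom L I),
  mono i -> exists g, g ** i = f.

(* Abelian categories whose objects have finite length; the axioms are
   self-dual. *)
Record abelian : Prop := Abelian {
  ab_zero : exists Z, idm Z = 0;
  ab_biproduct : forall X Y, exists S (i1 : hom X S) (i2 : hom Y S) p1 p2,
    biproduct i1 i2 p1 p2;
  ab_mono : forall X Y (i : hom X Y), mono i -> exists Z (p : hom Y Z), ses i p;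
  ab_epi : forall Y Z (p : hom Y Z), epi p -> exists X (i : hom X Y), ses i p;
  ab_image : forall X Y (f : hom X Y), exists E (q : hom X E) (m : hom E Y),
    [/\ epi q, mono m & f = m ** q];
  ab_length : exists len : ob C -> nat, forall X Y (f : hom X Y),
    (mono f -> (len X <= len Y)%N) /\ (epi f -> (len Y <= len X)%N) /\
    (len X = len Y -> mono f \/ epi f ->
       exists g, g ** f = idm X /\ f ** g = idm Y) }.

End Basic.

Lemma ses_op (C : precat) (X Y Z : ob C) (i : hom X Y) (p : hom Y Z) :
  ses i p -> @ses (opcat C) Z Y X p i.
Proof. by case=> hm he hc hk hq; split. Qed.

Lemma op_ses (C : precat) (X Y Z : ob C) (i : hom X Y) (p : hom Y Z) :
  @ses (opcat C) Z Y X p i -> ses i p.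
Proof. by case=> hm he hc hk hq; split. Qed.

Lemma short_op (C : precat) (X Y Z : ob C) : short X Y Z -> @short (opcat C) Z Y X.
Proof. by case=> i [p s]; exists p, i; apply: ses_op. Qed.

Lemma op_short (C : precat) (X Y Z : ob C) : @short (opcat C) Z Y X -> short X Y Z.
Proof. by case=> p [i s]; exists i, p; apply: op_ses. Qed.

Lemma abelian_op (C : precat) : abelian C -> abelian (opcat C).
Proof.
case=> hz hb hm he hi [len hl]; split.
- exact: hz.
- move=> X Y; have [S [i1 [i2 [p1 [p2 [e1 e2 e3 e4 e5]]]]]] := hb X Y.
  by exists S, p1, p2, i1, i2; split.
- by move=> X Y i mi; have [Z [p s]] := he _ _ _ mi; exists Z, p; apply: ses_op.
- by move=> X Y i mi; have [Z [p s]] := hm _ _ _ mi; exists Z, p; apply: ses_op.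
- by move=> X Y f; have [E [q [m [eq mm ->]]]] := hi _ _ f; exists E, m, q.
- exists len => X Y f; have [h1 [h2 h3]] := hl _ _ f; split=> //; split=> //.
  move=> e d; have [|g [g1 g2]] := h3 (esym e); first by case: d; [right|left].
  by exists g.
Qed.

Section Abelian.
Variables (C : precat) (abC : abelian C).
Implicit Types X Y Z W : ob C.

Lemma comp0m X Y Z (f : hom X Y) : (0 : hom Y Z) ** f = 0.
Proof. by apply: (addrI (0 ** f)); rewrite -compDl !addr0. Qed.

Lemma compm0 X Y Z (f : hom Y Z) : f ** (0 : hom X Y) = 0.
Proof. by apply: (addrI (f ** 0)); rewrite -compDr !addr0. Qed.

Lemma compNl X Y Z (f : hom Y Z) (g : hom X Y) : (- f) ** g = - (f ** g).
Proof. by apply: (addrI (f ** g)); rewrite -compDl !subrr comp0m. Qed.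

Lemma compNr X Y Z (f : hom Y Z) (g : hom X Y) : f ** (- g) = - (f ** g).
Proof. by apply: (addrI (f ** g)); rewrite -compDr !subrr compm0. Qed.

Lemma compBl X Y Z (f g : hom Y Z) (h : hom X Y) : (f - g) ** h = f ** h - g ** h.
Proof. by rewrite compDl compNl. Qed.

Lemma compBr X Y Z (f : hom Y Z) (g h : hom X Y) : f ** (g - h) = f ** g - f ** h.
Proof. by rewrite compDr compNr. Qed.

Lemma mono_cancel X Y (f : hom X Y) W (g h : hom W X) :
  mono f -> f ** g = f ** h -> g = h.
Proof. by move=> mf e; apply/subr0_eq/mf; rewrite compBr e subrr. Qed.

Lemma epi_cancel X Y (f : hom X Y) W (g h : hom Y W) :
  epi f -> g ** f = h ** f -> g = h.
Proof. by move=> ef e; apply/subr0_eq/ef; rewrite compBl e subrr. Qed.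

Lemma mono_comp X Y Z (f : hom Y Z) (g : hom X Y) : mono f -> mono g -> mono (f ** g).
Proof. by move=> mf mg W h; rewrite -compA => /mf/mg. Qed.

Lemma mono_compr X Y Z (f : hom Y Z) (g : hom X Y) : mono (f ** g) -> mono g.
Proof. by move=> m W h e; apply: m; rewrite -compA e compm0. Qed.

Lemma epi_compl X Y Z (f : hom Y Z) (g : hom X Y) : epi (f ** g) -> epi f.
Proof. by move=> m W h e; apply: m; rewrite compA e comp0m. Qed.

Lemma mono_id X : mono (idm X).
Proof. by move=> W g; rewrite comp1m. Qed.

Lemma epi_id X : epi (idm X).
Proof. by move=> W g; rewrite compm1. Qed.

Lemma split_mono X Y (r : hom Y X) (i : hom X Y) : r ** i = idm X -> mono i.
Proof. by move=> e; apply: (@mono_compr _ _ _ r); rewrite e; apply: mono_id. Qed.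

Lemma split_epi X Y (r : hom Y X) (i : hom X Y) : r ** i = idm X -> epi r.
Proof. by move=> e; apply: (@epi_compl _ _ _ _ i); rewrite e; apply: epi_id. Qed.

(** [i] is the kernel of its cokernel [c], and [c] factors through [p]. Whatever [p] kills is thus
    killed by [c] and factors through [i]. *)
Lemma cokernel_ses X Y Z (i : hom X Y) (p : hom Y Z) :
  mono i -> epi p -> p ** i = 0 ->
  (forall W (g : hom Y W), g ** i = 0 -> exists h, g = h ** p) -> ses i p.
Proof.
move=> mi ep pi hc; split=> // W g pg.
have [V [c s]] := ab_mono abC mi.
have [a ca] := hc _ c (ses_comp s).
by apply: (ses_ker s); rewrite ca -compA pg compm0.
Qed.

Lemma short_split X Y Z (i : hom X Y) (p : hom Y Z) (s : hom Z Y) :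
  ses i p -> p ** s = idm Z -> exists r, biproduct i s r p.
Proof.
move=> hs ps; have [r er] : exists r, idm Y - s ** p = i ** r.
  by apply: (ses_ker hs); rewrite compBr compm1 compA ps comp1m subrr.
have ri : r ** i = idm X.
  apply: (mono_cancel (ses_mono hs)); rewrite compA -er compBl comp1m compm1.
  by rewrite -compA (ses_comp hs) compm0 subr0.
exists r; split=> //.
- apply: (ses_mono hs); rewrite compA -er compBl comp1m -compA ps compm1.
  by rewrite subrr.
- exact: ses_comp hs.
- by rewrite -er subrK.
Qed.

Lemma biproduct_ses X Y S (i1 : hom X S) (i2 : hom Y S) p1 p2 :
  biproduct i1 i2 p1 p2 -> ses i1 p2.
Proof.
case=> e1 e2 e3 e4 e5; split=> //.
- exact: split_mono e1.
- exact: split_epi e2.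
- move=> W g eg; exists (p1 ** g); rewrite compA -{1}(comp1m g) -e5 compDl.
  by rewrite -(compA i2) eg compm0 addr0.
- move=> W g eg; exists (g ** i2); rewrite -compA -{1}(compm1 g) -e5 compDr.
  by rewrite (compA g i1) eg comp0m add0r.
Qed.

Lemma biproductC X Y S (i1 : hom X S) (i2 : hom Y S) p1 p2 :
  biproduct i1 i2 p1 p2 -> biproduct i2 i1 p2 p1.
Proof. by case=> e1 e2 e3 e4 e5; split=> //; rewrite addrC. Qed.

Lemma proj_retract X Y (s : hom X Y) (r : hom Y X) :
  r ** s = idm X -> proj Y -> proj X.
Proof.
move=> rs pY N L p f ep; have [g eg] := pY _ _ p (f ** r) ep.
by exists (g ** s); rewrite compA eg -compA rs compm1.
Qed.

Lemma proj_biproduct X Y S (i1 : hom X S) (i2 : hom Y S) p1 p2 :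
  biproduct i1 i2 p1 p2 -> proj X -> proj Y -> proj S.
Proof.
move=> b pX pY N L p f ep.
have [g1 e1] := pX _ _ p (f ** i1) ep; have [g2 e2] := pY _ _ p (f ** i2) ep.
exists (g1 ** p1 + g2 ** p2).
by rewrite compDr !compA e1 e2 -!compA -compDr (bipE b) compm1.
Qed.

Lemma proj_section X Y Z (i : hom X Y) (p : hom Y Z) :
  ses i p -> proj Z -> exists s r, biproduct i s r p.
Proof.
move=> hs pZ; have [s es] := pZ _ _ p (idm Z) (ses_epi hs).
by exists s; apply: short_split es.
Qed.

Lemma zero_proj Z : idm Z = 0 -> proj Z.
Proof.
move=> z N L p f _; exists 0.
by rewrite compm0 -(compm1 f) z compm0.
Qed.

Lemma short_zero Z M : idm Z = 0 -> short Z M M.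
Proof.
move=> z; exists 0, (idm M); split.
- by move=> W g _; rewrite -(comp1m g) z comp0m.
- exact: epi_id.
- exact: compm0.
- by move=> W g; rewrite comp1m => ->; exists 0; rewrite compm0.
- by move=> W g _; exists g; rewrite compm1.
Qed.

(** * Pushouts and the diagrams built from them *)

Record pushout X Y X' E (i : hom X Y) (f : hom X X') (g : hom Y E) (j : hom X' E)
    : Prop := Pushout {
  po_comm : g ** i = j ** f;
  po_univ : forall W (a : hom Y W) (b : hom X' W), a ** i = b ** f ->
    exists h, h ** g = a /\ h ** j = b;
  po_joint : forall W (h : hom E W), h ** g = 0 -> h ** j = 0 -> h = 0 }.

(** The pushout is the cokernel of [u = (i, - f)] into the biproduct of [Y] and [X']. What a leg
    kills comes from some [x] in [X], and the component of [u] on the other side forces [x] to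
    vanish. *)
Lemma pushout_exists X Y X' (i : hom X Y) (f : hom X X') : mono i ->
  exists E (g : hom Y E) (j : hom X' E),
    [/\ pushout i f g j, mono j & mono f -> mono g].
Proof.
move=> mi; have [S [i1 [i2 [p1 [p2 b]]]]] := ab_biproduct abC Y X'.
pose u := i1 ** i - i2 ** f.
have p1u : p1 ** u = i.
  by rewrite compBr !compA (bip11 b) (bip12 b) comp1m comp0m subr0.
have p2u : p2 ** u = - f.
  by rewrite compBr !compA (bip22 b) (bip21 b) comp1m comp0m sub0r.
have mu : mono u by apply: (@mono_compr _ _ _ p1); rewrite p1u.
have [E [e s]] := ab_mono abC mu.
exists E, (e ** i1), (e ** i2); split; first split.
- by apply/subr0_eq; rewrite -!compA -compBr (ses_comp s).
- move=> W a c eac; have [|h eh] := ses_cok s (g := a ** p1 + c ** p2).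
    by rewrite compDl -!compA p1u p2u compNr eac subrr.
  exists h; rewrite !compA -eh !compDl -!compA (bip11 b) (bip12 b) (bip22 b).
  by rewrite (bip21 b) !compm0 !compm1 addr0 add0r.
- move=> W h h1 h2; apply: (ses_epi s).
  rewrite -(compm1 (h ** e)) -(bipE b) compDr !compA.
  rewrite -(compA h) h1 -(compA h) h2 !comp0m addr0 //.
- move=> W a; rewrite -compA => /(ses_ker s)[x ex].
  have x0 : x = 0.
    by apply: mi; rewrite -p1u -compA -ex compA (bip12 b) comp0m.
  by apply: (split_mono (bip22 b)); rewrite ex x0 compm0.
- move=> mf W a; rewrite -compA => /(ses_ker s)[x ex].
  have x0 : x = 0.
    apply: mf; apply/eqP; rewrite -oppr_eq0 -compNl -p2u -compA -ex compA.
    by rewrite (bip21 b) comp0m.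
  by apply: (split_mono (bip11 b)); rewrite ex x0 compm0.
Qed.

Lemma pushout_sym X Y X' E (i : hom X Y) (f : hom X X') (g : hom Y E) (j : hom X' E) :
  pushout i f g j -> pushout f i j g.
Proof.
case=> e u t; split=> [//|W a b eab|W h h1 h2]; last exact: t.
by have [h [h1 h2]] := u _ _ _ (esym eab); exists h.
Qed.

(** The cokernel does not change: [q] is [p] on [Y] and zero on [X']. *)
Lemma pushout_ses X Y Z X' E (i : hom X Y) (p : hom Y Z) (f : hom X X')
    (g : hom Y E) (j : hom X' E) :
  ses i p -> pushout i f g j -> mono j -> exists2 q, ses j q & q ** g = p.
Proof.
move=> s po mj; have [|q [qg qj]] := po_univ po (a := p) (b := 0).
  by rewrite (ses_comp s) comp0m.
exists q => //; apply: cokernel_ses => //.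
  by apply: (@epi_compl _ _ _ _ g); rewrite qg; apply: ses_epi s.
move=> W h hj; have [|k ek] := ses_cok s (g := h ** g).
  by rewrite -compA (po_comm po) compA hj comp0m.
exists k; apply/subr0_eq/(po_joint po); rewrite compBl -compA ?qg ?qj ?ek ?subrr //.
by rewrite hj compm0 subrr.
Qed.

Lemma pushout_short X Y Z Y' Z' :
  short X Y Z -> short X Y' Z' -> exists2 E, short Y' E Z & short Y E Z'.
Proof.
move=> [i [p s]] [f [f1 s']].
have [E [g [j [po mj mg]]]] := pushout_exists f (ses_mono s).
have [q sq _] := pushout_ses s po mj.
have [q' sq' _] := pushout_ses s' (pushout_sym po) (mg (ses_mono s')).
by exists E; [exists j, q | exists g, q'].
Qed.

(** The third isomorphism theorem for [X] inside [Y] inside [G]; the quotient [V] of [G] by [X] is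
    the pushout of [G] along [p]. *)
Lemma short_comp X Y Z G Y1 : short X Y Z -> short Y G Y1 ->
  exists2 V, short X G V & short Z V Y1.
Proof.
move=> [i [p s]] [j [q s']].
have [V [v [k [po mk _]]]] := pushout_exists p (ses_mono s').
have [l sl lv] := pushout_ses s' po mk.
exists V; last by exists k, l.
have vj := po_comm po.
exists (j ** i), v; apply: cokernel_ses.
- exact: mono_comp (ses_mono s') (ses_mono s).
- move=> W h hv; apply: (po_joint po) => //; apply: (ses_epi s).
  by rewrite -compA -vj compA hv comp0m.
- by rewrite compA vj -compA (ses_comp s) compm0.
- move=> W h; rewrite compA => /(ses_cok s)[a ea].
  by have [b [<- _]] := po_univ po ea; exists b.
Qed.

(** The sequence splits, and its biproduct can be read from the other end. *)
Lemma short_proj_sym X Y Z : proj Z -> short X Y Z -> short Z Y X.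
Proof.
move=> pZ [i [p s]]; have [t [r b]] := proj_section s pZ.
by exists t, r; apply: biproduct_ses (biproductC b).
Qed.

Lemma short_proj_mid X Y Z : proj X -> proj Z -> short X Y Z -> proj Y.
Proof.
by move=> pX pZ [i [p s]]; have [t [r b]] := proj_section s pZ; apply: proj_biproduct b _ _.
Qed.

Lemma short_proj_left X Y Z : proj Y -> proj Z -> short X Y Z -> proj X.
Proof.
move=> pY pZ [i [p s]]; have [t [r b]] := proj_section s pZ.
exact: proj_retract (bip11 b) pY.
Qed.

End Abelian.

(** * Transfer to the opposite category *)

Section Dual.
Variables (C : precat) (abC : abelian C).
Implicit Types X Y Z W : ob C.

Lemma inj_retract X Y (s : hom X Y) (r : hom Y X) :
  r ** s = idm X -> inj Y -> inj X.
Proof. exact (@proj_retract (opcat C) X Y r s). Qed.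

Lemma zero_inj Z : idm Z = 0 -> inj Z.
Proof. exact: (@zero_proj (opcat C)). Qed.

Lemma short_inj_sym X Y Z : inj X -> short X Y Z -> short Z Y X.
Proof.
by move=> iX s; apply/op_short/(@short_proj_sym (opcat C))/short_op.
Qed.

Lemma short_inj_mid X Y Z : inj X -> inj Z -> short X Y Z -> inj Y.
Proof.
by move=> iX iZ /short_op s; apply: (@short_proj_mid (opcat C) Z Y X).
Qed.

Lemma pullback_short X Y Z X' Y' :
  short X Y Z -> short X' Y' Z -> exists2 E, short X E Y' & short X' E Y.
Proof.
move=> /short_op s /short_op s'.
have [E s1 s2] := pushout_short (abelian_op abC) s s'.
by exists E; apply/op_short.
Qed.

Lemma short_comp_dual X Y Z G Y1 : short X Y Z -> short Y1 G Y ->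
  exists2 V, short V G Z & short Y1 V X.
Proof.
move=> /short_op s /short_op s'.
have [E s1 s2] := short_comp (abelian_op abC) s s'.
by exists E; apply/op_short.
Qed.

Lemma pullback_lift X Y Z Z' (i : hom X Y) (p : hom Y Z) (f : hom Z' Z) :
  ses i p -> exists E (g : hom E Y) (q : hom E Z') (j : hom X E),
    ses j q /\ p ** g = f ** q.
Proof.
move=> /ses_op s.
have [E [g [q [po mq _]]]] := pushout_exists (abelian_op abC) f (ses_mono s).
have [j sj _] := pushout_ses (abelian_op abC) s po mq.
exists E, g, q, j; split; first exact: (op_ses sj).
exact: (po_comm po).
Qed.

End Dual.
(** * Projective and dominant dimension *)

Section Dimensions.
Variable C : precat.

Definition projinj (E : ob C) := proj E /\ inj E.

Fixpoint pd_le n (M : ob C) : Prop :=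
  if n is n'.+1 then exists E M', [/\ proj E, short M' E M & pd_le n' M'] else proj M.

Fixpoint dd_ge n (M : ob C) : Prop :=
  if n is n'.+1 then exists E M', [/\ projinj E, short M E M' & dd_ge n' M'] else True.

Lemma dd_geS n M :
  dd_ge n.+1 M = exists E M', [/\ projinj E, short M E M' & dd_ge n M'].
Proof. by []. Qed.

End Dimensions.

Definition id_le (C : precat) n (M : ob C) := @pd_le (opcat C) n M.
(** The double opposite has the objects, arrows and composition of [C] but other proof fields, hence
    an induction instead of conversion. *)
Lemma id_le_op (C : precat) n (M : ob C) : @id_le (opcat C) n M <-> pd_le n M.
Proof.
elim: n M => [//|n IHn] M.
split=> -[E [M' [pE s h]]]; exists E, M'; split=> //; try exact/IHn.
  by apply: op_short; apply: op_short.
by apply: short_op; apply: short_op.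
Qed.

Definition cd_ge (C : precat) n (M : ob C) := @dd_ge (opcat C) n M.

(** * The bounds along short exact sequences *)

Section DimensionTheory.
Variables (C : precat) (abC : abelian C).
Implicit Types X Y Z W M N E F G : ob C.

Lemma short_projinj_mid X Y Z : projinj X -> projinj Z -> short X Y Z -> projinj Y.
Proof.
move=> [pX iX] [pZ iZ] s; split; first exact: short_proj_mid s.
exact: short_inj_mid s.
Qed.

Lemma dd_ge_projinj n E : projinj E -> dd_ge n E.
Proof.
have [z z0] := ab_zero abC.
have pz : projinj z by split; [apply: zero_proj | apply: zero_inj].
elim: n E => [//|n IHn] E pE; exists E, z; split=> //; last exact: IHn.
apply: (short_inj_sym pz.2); exact: short_zero.
Qed.

Lemma dd_geW n M : dd_ge n.+1 M -> dd_ge n M.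
Proof.
elim: n M => [//|n IHn] M [E [M1 [pE s h]]].
by exists E, M1; split=> //; apply: IHn.
Qed.

Lemma dd_ge_leq m n M : (m <= n)%N -> dd_ge n M -> dd_ge m M.
Proof. by move/subnK <-; elim: (n - m)%N => [//|k IHk] /dd_geW. Qed.

(** A horseshoe argument. Pushing out along [X -> F] embeds [Y] into [E], an extension of [Z] by [F]
    that splits since [F] is injective. Embedding [Z] into [G] then enlarges [E] to an extension [S]
    of [F] by [G], and the cokernel [V] of [Y] in [S] is an extension of [Z1] by [X1]. *)
Lemma dd_ge_ext n X Y Z : short X Y Z -> dd_ge n X -> dd_ge n Z -> dd_ge n Y.
Proof.
elim: n X Y Z => [//|n IHn] X Y Z s [F [X1 [pF sF hX]]] [G [Z1 [pG sG hZ]]].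
have [E sE1 sE2] := pushout_short abC s sF.
have sE3 := short_inj_sym pF.2 sE1.
have [S sS1 sS2] := pushout_short abC sG sE3.
have [V sV1 sV2] := short_comp abC sE2 sS1.
exists S, V; split=> //; last exact: IHn sV2 hX hZ.
exact: short_projinj_mid sS2.
Qed.

(** The cokernel [V] of [X] in [G] is an extension of [Y1] by [Z]. *)
Lemma dd_ge_left n X Y Z : short X Y Z -> dd_ge n.+1 Y -> dd_ge n Z -> dd_ge n.+1 X.
Proof.
move=> s [G [Y1 [pG sG hY]]] hZ; have [V sV1 sV2] := short_comp abC s sG.
by exists G, V; split=> //; apply: dd_ge_ext sV2 hZ hY.
Qed.

(** A dual Schanuel argument: the pushout [E] of [F] and [I] under [M] is an extension of [N] by
    [I], and it contains [M1] as a summand with complement [F]. *)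
Lemma dd_ge_cosyzygy n M F N I M1 : projinj F -> short M F N ->
  projinj I -> short M I M1 -> dd_ge n N -> dd_ge n M1.
Proof.
case: n => [//|n] pF sF pI sI hN; have [E sE1 sE2] := pushout_short abC sF sI.
have hE := dd_ge_ext sE1 (dd_ge_projinj n.+1 pI) hN.
apply: (dd_ge_left (short_inj_sym pF.2 sE2) hE).
exact: dd_ge_projinj.
Qed.

(** The quotient [W] of [G] by [X] is a cosyzygy of [X], so it inherits the bound of [X1]. It
    contains [Z] with quotient [Y1], which reduces the claim to a kernel. *)
Lemma dd_ge_right n X Y Z : short X Y Z -> dd_ge n.+1 X -> dd_ge n Y -> dd_ge n Z.
Proof.
case: n => [//|n] s; rewrite (dd_geS n.+1) (dd_geS n Y).
move=> [F [X1 [pF sF hX]]] [G [Y1 [pG sG hY]]].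
have [W sW1 sW2] := short_comp abC s sG.
have hW := dd_ge_cosyzygy pF sF pG sW1 hX.
exact: (dd_ge_left sW2 hW hY).
Qed.

(** The two summands help each other: a bound [n] on [Z] yields the bound [n.+1] on [X], and
    conversely. *)
Lemma dd_ge_summand n X Y Z :
  short X Y Z -> short Z Y X -> dd_ge n Y -> dd_ge n X.
Proof.
elim: n X Z => [//|n IHn] X Z s1 s2 hY; apply: (dd_ge_left s1 hY).
exact: IHn s2 s1 (dd_geW hY).
Qed.

Lemma pd_leW n M : pd_le n M -> pd_le n.+1 M.
Proof.
have [z z0] := ab_zero abC.
elim: n M => [|n IHn] M.
  by exists M, z; split=> //; [apply: short_zero | apply: zero_proj].
by move=> [E [M' [pE s h]]]; exists E, M'; split=> //; apply: IHn.
Qed.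

Lemma pd_le_leq m n M : (m <= n)%N -> pd_le m M -> pd_le n M.
Proof. by move/subnK <- => h; elim: (n - m)%N => [//|k IHk]; apply: pd_leW. Qed.

(** [Y] is [X] plus [E], so adding [E] to a cover of [X] gives a cover of [Y] with the same
    kernel. *)
Lemma pd_le_add n X Y E : short X Y E -> proj E -> pd_le n X -> pd_le n Y.
Proof.
case: n => [|n] s pE /=; first by move=> pX; apply: short_proj_mid s.
move=> [F [X' [pF sF h]]].
have [G sG1 sG2] := pullback_short abC (short_proj_sym pE s) sF.
by exists G, X'; split=> //; apply: short_proj_mid sG1.
Qed.

(** The preimage [V] of [X] in a cover [F] of [Y] is a summand of [F], and it covers [X] with the
    same kernel. *)
Lemma pd_le_sub n X Y E : short X Y E -> proj E -> pd_le n Y -> pd_le n X.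
Proof.
case: n => [|n] s pE /=; first by move=> pY; apply: short_proj_left s.
move=> [F [X' [pF sF h]]]; have [V sV1 sV2] := short_comp_dual abC s sF.
by exists V, X'; split=> //; apply: short_proj_left sV1.
Qed.

(** Schanuel's lemma: the pullback [G] of two projective covers of [Y] is both [X] plus [F] and [Y']
    plus [E]. *)
Lemma pd_le_syzygy n X E Y : short X E Y -> proj E -> pd_le n.+1 Y -> pd_le n X.
Proof.
move=> s pE [F [Y' [pF sF h]]]; have [G sG1 sG2] := pullback_short abC s sF.
exact: pd_le_sub sG1 pF (pd_le_add sG2 pE h).
Qed.

(** * Consequences of the two bounds by [d], and their duals *)

Section Bounded.
Variable d : nat.
Hypothesis pd_bound : forall M, pd_le d M.
Hypothesis dd_proj : forall P : ob C, proj P -> dd_ge d P.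

Lemma dd_ge_pd p M : (p <= d)%N -> pd_le p M -> dd_ge (d - p) M.
Proof.
elim: p M => [|p IHp] M lpd; first by rewrite subn0; apply: dd_proj.
move=> [E [M' [pE s h]]]; apply: dd_ge_right s _ _.
  by rewrite subnSK //; apply: IHp => //; apply: ltnW.
by apply: dd_ge_leq (leq_subr _ _) (dd_proj pE).
Qed.

(** The [n]-th cosyzygy has projective dimension at most [d], and each step back to a kernel lowers
    the bound by one. *)
Lemma pd_le_dd n k M : (n + k = d)%N -> dd_ge n M -> pd_le k M.
Proof.
elim: n k M => [|n IHn] k M; first by rewrite add0n => ->.
rewrite addSnnS => e [E [M' [pE s h]]]; apply: pd_le_syzygy s pE.1 _.
exact: IHn e h.
Qed.

Lemma dd_lt p M : ~ projinj M -> (p <= d)%N -> pd_le p M ->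
  (forall k, (k < p)%N -> ~ pd_le k M) -> ~ dd_ge (d - p).+1 M.
Proof.
case: p => [|p] nM lpd hp minp hd.
  rewrite subn0 in hd; have [E [M1 [pE [i [q s]] h]]] := hd.
  (* The cokernel [M1] has dominant dimension at least [d], hence is projective; so [M] is a summand
     of [E]. *)
  apply: nM; split=> //; have pM1 : proj M1 := pd_le_dd (addn0 d) h.
  by have [t [r b]] := proj_section s pM1; apply: inj_retract (bip11 b) pE.2.
(* Here [(d - p.+1).+1 + p = d], so the bound would give [pd_le p M], against minimality. *)
by apply: (minp p) => //; apply: pd_le_dd hd; rewrite addSnnS subnK.
Qed.

(** Vanishing of Ext^1(N, M), phrased as the splitting of all extensions. *)
Definition split_ext N M := forall E (i : hom M E) (p : hom E N),
  ses i p -> exists s, p ** s = idm N.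

Lemma split_ext_proj N M : proj N -> split_ext N M.
Proof. by move=> pN E i p s; apply: (pN _ _ p (idm N) (ses_epi s)). Qed.

(** Pushing [i] out along [f] gives an extension of the cokernel of [i] by [M]; a retraction of it
    extends [f]. *)
Lemma split_ext_inj M : (forall N, split_ext N M) -> inj M.
Proof.
move=> sM N L i f mi; have [V [c s]] := ab_mono abC mi.
have [E [g [j [po mj _]]]] := pushout_exists abC f mi.
have [q sq _] := pushout_ses abC s po mj.
have [t et] := sM _ _ _ _ sq; have [r b] := short_split sq et.
by exists (r ** g); rewrite -compA (po_comm po) compA (bip11 b) comp1m.
Qed.

(* Ext^1(N, Z) = Ext^2(N, M) = Ext^1(N', M), on the level of extensions. *)
Lemma split_ext_shift M J Z N' P N : short M J Z -> inj J ->
  short N' P N -> proj P -> split_ext N' M -> split_ext N Z.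
Proof.
move=> [c [z sz]] iJ [n [q sq]] pP sp E i p s.
have [l el] := pP _ _ p q (ses_epi s).
have [|f ef] := ses_ker s (g := l ** n); first by rewrite compA el (ses_comp sq).
(* The pulled back extension of [N'] by [M] splits, so [f] lifts to [J]; the lift extends to [h] on
   [P]. Correcting [l] by [i ** (z ** h)] kills [N'] and descends to a section. *)
have [E' [e2 [e1 [j [sj ee]]]]] := pullback_lift abC f sz.
have [t et] := sp _ _ _ sj.
have [h eh] := iJ _ _ n (e2 ** t) (ses_mono sq).
have [|k ek] := ses_cok sq (g := l - i ** (z ** h)).
  rewrite compBl -!compA eh ef (compA z) ee -(compA f) et compm1 subrr //.
exists k; apply: (epi_cancel (ses_epi sq)).
by rewrite comp1m -compA -ek compBr el !compA (ses_comp s) !comp0m subr0.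
Qed.

Hypothesis enough_inj : forall M, exists J (i : hom M J), inj J /\ mono i.

Lemma id_bound M : id_le d M.
Proof.
(* Dimension shifting: each cosyzygy raises by one the [n] for which Ext^1 vanishes on all [N] with
   [pd_le n N]. At [n = d] these are all objects, and the cosyzygy is injective. *)
suff gen k n M' : (n + k = d)%N ->
    (forall N, pd_le n N -> split_ext N M') -> id_le k M'.
  by apply: (gen d 0%N) => // N; apply: split_ext_proj.
elim: k n M' => [|k IHk] n M' e h.
  apply: split_ext_inj => N; apply: h; rewrite addn0 in e; rewrite e //.
have [J [i [iJ mi]]] := enough_inj M'; have [Z [p s]] := ab_mono abC mi.
exists J, Z; split=> //; first by apply: short_op; exists i, p.
apply: (IHk n.+1); first by rewrite addSnnS.
move=> N [P [N' [pP sN hN']]]; apply: split_ext_shift _ iJ sN pP (h _ hN').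
by exists i, p.
Qed.

(* For X = I injective and k = 0 this is the lifting property of I; it passes to
   the kernel of an epimorphism from a projective-injective object onto X. *)
Definition coext k X := forall Q F Q1 (i : hom Q F) (q : hom F Q1), ses i q ->
  projinj F -> dd_ge k Q1 -> forall f : hom Q X, exists g, g ** i = f.

Lemma coext_syzygy k X' E X : short X' E X -> projinj E -> coext k X -> coext k.+1 X'.
Proof.
move=> [a [b s]] pE hX Q F Q1 i q sQ pF [F1 [Q2 [pF1 [i1 [q1 sQ1]] hQ2]]] f.
(* [g] extends [a ** f] to [F] but may miss [X']. Its image [h] in [X] extends to [F1] by [hX] and
   lifts to [h2], since [F1] is projective; subtracting this from [g] changes nothing on [Q]. *)
have [g eg] := pE.2 _ _ i (a ** f) (ses_mono sQ).
have [|h eh] := ses_cok sQ (g := b ** g).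
  by rewrite -compA eg compA (ses_comp s) comp0m.
have [h1 eh1] := hX _ _ _ _ _ sQ1 pF1 hQ2 h.
have [h2 eh2] := pF1.1 _ _ b h1 (ses_epi s).
have [|k' ek] := ses_ker s (g := g - h2 ** i1 ** q).
  by rewrite compBr !compA eh2 eh1 eh subrr.
exists k'; apply: (mono_cancel (ses_mono s)).
by rewrite compA -ek compBl eg -!compA (ses_comp sQ) !compm0 subr0.
Qed.

Hypothesis enough_proj : forall M, exists P (p : hom P M), proj P /\ epi p.

Lemma cd_ge_coext k m X : (k + m = d)%N -> coext k X -> cd_ge m X.
Proof.
elim: m k X => [//|m IHm] k X e hX.
have [Q [p [pQ ep]]] := enough_proj X.
(* From [k + m.+1 = d] follows [k.+1 <= d]. The extension of [p] from [Q] to [F] is still epi, so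
   [X] is covered by a projective-injective object. *)
have : dd_ge k.+1 Q by apply: dd_ge_leq (dd_proj pQ); rewrite -e addnS ltnS leq_addr.
move=> [F [Q1 [pF [i [q s]] hQ1]]].
have [g eg] := hX _ _ _ _ _ s pF hQ1 p.
have eg' : epi g by apply: (@epi_compl _ _ _ _ _ i); rewrite eg.
have [X' [a sa]] := ab_epi abC eg'.
have sX : short X' F X by exists a, g.
exists F, X'; split; [by case: pF | exact: short_op |].
by apply: (IHm k.+1); [rewrite addSnnS | apply: coext_syzygy sX pF hX].
Qed.

Lemma cd_inj (I : ob C) : inj I -> cd_ge d I.
Proof.
move=> iI; apply: (@cd_ge_coext 0%N) => // Q F Q1 i q s _ _ f.
exact: iI (ses_mono s).
Qed.

End Bounded.
End DimensionTheory.

(** * Injective envelopes and minimal coresolutions *)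

Section Minimal.
Variables (C : precat) (abC : abelian C).
Implicit Types X Y Z W M I J : ob C.

Definition essential X Y (i : hom X Y) :=
  forall W (g : hom Y W), mono (g ** i) -> mono g.

(** The embedding of [M] into [F] extends to [I] as [F] is injective; essentiality makes the
    extension mono, and it splits since [I] is injective. So [I] is a summand of [F]. *)
Lemma essential_dd n M I M1 (i : hom M I) (p : hom I M1) : ses i p -> inj I ->
  essential i -> dd_ge n.+1 M -> proj I /\ dd_ge n M1.
Proof.
move=> s iI ei [F [N [pF [a [b sF]] hN]]].
have [g eg] := pF.2 _ _ i a (ses_mono s).
have mg : mono g by apply: ei; rewrite eg; apply: ses_mono sF.
have [r er] := iI _ _ g (idm I) mg.
have pI := proj_retract er pF.1; split=> //.
have sF' : short M F N by exists a, b.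
have sI : short M I M1 by exists i, p.
exact: dd_ge_cosyzygy abC _ _ _ _ _ _ pF sF' (conj pI iI) sI hN.
Qed.

Section Resolution.
Variables (I Z : nat -> ob C).
Variables (i : forall n, hom (Z n) (I n)) (p : forall n, hom (I n) (Z n.+1)).
Hypotheses (sip : forall n, ses (i n) (p n)) (injI : forall n, inj (I n)).

Lemma coresolution_id n k :
  (forall m, (n < m)%N -> idm (I (k + m)%N) = 0) -> id_le n (Z k).
Proof.
elim: n k => [|n IHn] k h.
  (* [Z k.+1] embeds into [I k.+1], which is zero; thus [Z k] is a retract of [I k]. *)
  have z1 : idm (Z k.+1) = 0.
    apply: (ses_mono (sip k.+1)); rewrite compm1 -[i k.+1]comp1m.
    by rewrite -addn1 (h 1%N) // comp0m.
  have [t [r b]] := proj_section (sip k) (zero_proj z1).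
  exact: inj_retract (bip11 b) (@injI k).
exists (I k), (Z k.+1); split; first exact: injI.
  by apply: short_op; exists (i k), (p k).
by apply: IHn => m lm; rewrite addSnnS; apply: h.
Qed.

Lemma coresolution_dd n k :
  (forall m, (m < n)%N -> proj (I (k + m)%N)) -> dd_ge n (Z k).
Proof.
elim: n k => [//|n IHn] k h; exists (I k), (Z k.+1); split.
- by split=> //; have := h 0%N; rewrite addn0; apply.
- by exists (i k), (p k).
- by apply: IHn => m lm; rewrite addSnnS; apply: h.
Qed.

Hypothesis essi : forall n, essential (i n).

Lemma minimal_coresolution_proj n k m :
  dd_ge n (Z k) -> (m < n)%N -> proj (I (k + m)%N).
Proof.
elim: n k m => [//|n IHn] k m h.
have [pI h'] := essential_dd (sip k) (@injI k) (@essi k) h.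
by case: m => [|m] lm; [rewrite addn0 | rewrite -addSnnS; apply: IHn].
Qed.

Lemma minimal_coresolution_dd n : dd_ge n (Z 0) -> ~ dd_ge n.+1 (Z 0) ->
  (forall k, (k < n)%N -> proj (I k)) /\ ~ proj (I n).
Proof.
move=> h1 h2; split=> [k lk|pI]; first exact: (@minimal_coresolution_proj n 0 k).
apply: h2; apply: coresolution_dd => m; rewrite ltnS leq_eqVlt add0n.
by move=> /orP[/eqP->//|lm]; apply: (@minimal_coresolution_proj n 0 m).
Qed.

End Resolution.

Lemma coresolution_cons M E (i0 : hom M E) (I Z : nat -> ob C) (p0 : hom E (Z 0))
    (i : forall n, hom (Z n) (I n)) (p : forall n, hom (I n) (Z n.+1)) :
  let I' n := if n is m.+1 then I m else E in
  let Z' n := if n is m.+1 then Z m else M in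
  ses i0 p0 -> (forall n, ses (i n) (p n)) ->
  exists (i' : forall n, hom (Z' n) (I' n)) (p' : forall n, hom (I' n) (Z' n.+1)),
    forall n, ses (i' n) (p' n).
Proof.
move=> I' Z' s0 s.
pose i' n : hom (Z' n) (I' n) := if n is m.+1 then i m else i0.
pose p' n : hom (I' n) (Z' n.+1) := if n is m.+1 then p m else p0.
by exists i', p'; case.
Qed.

Lemma id_coresolution n M : id_le n M ->
  exists (I Z : nat -> ob C) (i : forall n, hom (Z n) (I n))
    (p : forall n, hom (I n) (Z n.+1)),
    [/\ Z 0 = M, forall n, ses (i n) (p n), forall n, inj (I n)
      & forall m, (n < m)%N -> idm (I m) = 0].
Proof.
elim: n M => [|n IHn] M.
  (* A finite coresolution is continued by zero objects. *)
  move=> iM; have [z z0] := ab_zero abC.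
  have [i0 [p0 s0]] := short_inj_sym (zero_inj z0) (short_zero M z0).
  have [iz [pz sz]] := short_zero z z0.
  have [i [p s]] := coresolution_cons s0 (fun _ : nat => sz).
  exists (fun n => if n is _.+1 then z else M), (fun n => if n is _.+1 then z else M), i, p.
  by split=> //; case=> // _; apply: zero_inj.
move=> [E [M' [iE s h]]]; have [I [Z [i [p [e s' iI hI]]]]] := IHn M' h.
subst M'; have [i0 [p0 s0]] := op_short s.
have [i' [p' s'']] := coresolution_cons s0 s'.
exists (fun n => if n is m.+1 then I m else E), (fun n => if n is m.+1 then Z m else M), i', p'.
by split=> //; case=> // m; apply: hI.
Qed.

(* Fitting's lemma: S is the image of a power of e on which e is bijective. *)
Lemma fitting (len : ob C -> nat) J (e : hom J J) :
  (forall X Y (f : hom X Y),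
    (mono f -> (len X <= len Y)%N) /\ (epi f -> (len Y <= len X)%N) /\
    (len X = len Y -> mono f \/ epi f ->
       exists g, g ** f = idm X /\ f ** g = idm Y)) ->
  exists S (s : hom S J) (r : hom J S) (u : hom S S),
    [/\ r ** s = idm S, e ** s = s ** u,
       exists v, u ** v = idm S /\ v ** u = idm S,
       forall W (f : hom W J), e ** f = f -> exists f', f = s ** f'
     & mono e \/ (len S < len J)%N].
Proof.
move=> hlen; have [k] := ubnP (len J); elim: k => // k IHk in J e *.
rewrite ltnS => lk; have [me|nme] := pselect (mono e).
  have [g [g1 g2]] := (hlen _ _ e).2.2 erefl (or_introl me).
  exists J, (idm J), (idm J), e; split; rewrite ?comp1m ?compm1 //; first by exists g.
    by move=> W f _; exists f; rewrite comp1m.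
  by left.
have [E [q [m [eq mm em]]]] := ab_image abC e.
have lE : (len E < len J)%N.
  rewrite ltn_neqAle ((hlen _ _ m).1 mm) andbT; apply/negP => /eqP El; apply: nme.
  have [g [gq _]] := (hlen _ _ q).2.2 (esym El) (or_intror eq).
  by rewrite em; apply: mono_comp mm (split_mono gq).
(* On its image [E], shorter than [J], [e] acts as [q ** m]. Passing back to [J], the composite
   [r ** q ** m ** s] is [u], whence the factor [v] in the retraction. *)
have [S [s [r [u [rs es [v [uv vu]] fx _]]]]] := IHk E (q ** m) (leq_trans lE lk).
exists S, (m ** s), (v ** r ** q), u; split.
- by rewrite -!compA (compA q m) es (compA r) rs comp1m vu.
- by rewrite em -!compA (compA q m) es.
- by exists v.
- move=> W f ef; have [|f' ef'] := fx _ (q ** f).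
    by rewrite -{2}ef em !compA.
  by exists f'; rewrite -compA -ef' compA -em.
- by right; apply: leq_ltn_trans lE; apply: (hlen _ _ s).1; apply: split_mono rs.
Qed.

Hypothesis enough_inj : forall M, exists J (i : hom M J), inj J /\ mono i.

(** Induction on the length of an injective [J] containing [M]. If [g ** i] is mono but [g] is not,
    then [i] extends along [g ** i] to [h], and [h ** g] fixes [i] without being mono. Fitting's
    lemma yields a shorter summand of [J] containing [M]. *)
Lemma injective_envelope M : exists I Z (i : hom M I) (p : hom I Z),
  [/\ ses i p, inj I & essential i].
Proof.
have [len hlen] := ab_length abC.
suff: exists J (i : hom M J), [/\ inj J, mono i & essential i].
  move=> [J [i [iJ mi ei]]]; have [Z [p s]] := ab_mono abC mi.
  by exists J, Z, i, p.
have [J [i [iJ mi]]] := enough_inj M; have [k] := ubnP (len J).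
elim: k => // k IHk in J i iJ mi *.
rewrite ltnS => lk; have [ei|] := pselect (essential i); first by exists J, i.
move=> /existsNP[W /existsNP[g /not_implyP[mgi nmg]]].
have [h eh] := iJ _ _ (g ** i) i mgi; rewrite compA in eh.
have [S [s [r [u [rs _ _ fx]]]]] := fitting (h ** g) hlen.
case=> [me|lS]; first by case: nmg; apply: mono_compr me.
have [i' ei'] := fx _ _ eh.
apply: (IHk S i'); last exact: leq_trans lS lk.
  exact: inj_retract rs iJ.
by apply: (@mono_compr _ _ _ _ s); rewrite -ei'.
Qed.

Lemma minimal_coresolution M :
  exists (I Z : nat -> ob C) (i : forall n, hom (Z n) (I n))
    (p : forall n, hom (I n) (Z n.+1)),
    [/\ Z 0 = M, forall n, ses (i n) (p n), forall n, inj (I n)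
      & forall n, essential (i n)].
Proof.
have [I hI] := choice injective_envelope.
have [Z hZ] := choice hI.
pose i M := cid (hZ M); pose p M := cid (projT2 (i M)).
pose Zn n := iter n Z M.
exists (fun n => I (Zn n)), Zn, (fun n => projT1 (i (Zn n))), (fun n => projT1 (p (Zn n))).
by split=> // n; have [] := projT2 (p (Zn n)).
Qed.

End Minimal.
(** * Linear maps and submodules *)

Section LinearMaps.
Variable R : nzRingType.
Implicit Types M N L : lmodType R.

Lemma linear_ext M N (f g : {linear M -> N}) : f =1 g -> f = g.
Proof.
case: f g => f [[f1] [f2]] [g [[g1] [g2]]] /= /funext e; subst g.
by rewrite (Prop_irrelevance f1 g1) (Prop_irrelevance f2 g2).
Qed.

Lemma linear_mk M N (f : M -> N) : linear f -> exists g : {linear M -> N}, g =1 f.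
Proof.
move=> lf; pose m := GRing.isLinear.Build R M N *:%R f lf.
by exists (HB.pack_for {linear M -> N} f m).
Qed.

(** An alias that carries the additive group structure, with classical equality and choice. *)
Definition linhom M N := {linear M -> N}.
HB.instance Definition _ M N := gen_eqMixin (linhom M N).
HB.instance Definition _ M N := gen_choiceMixin (linhom M N).

Section Zmod.
Variables M N : lmodType R.
Implicit Types f g : linhom M N.

Definition linhom0 : linhom M N := (\0 : {linear M -> N}).
Definition linhom_add f g : linhom M N := ((f : {linear M -> N}) \+ (g : {linear M -> N})).
Definition linhom_opp f : linhom M N := (\- (f : {linear M -> N})).

Lemma linhom_addA : associative linhom_add.
Proof. by move=> f g h; apply: linear_ext => x /=; rewrite addrA. Qed.
Lemma linhom_addC : commutative linhom_add.
Proof. by move=> f g; apply: linear_ext => x /=; rewrite addrC. Qed.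
Lemma linhom_add0 : left_id linhom0 linhom_add.
Proof. by move=> f; apply: linear_ext => x /=; rewrite add0r. Qed.
Lemma linhom_addN : left_inverse linhom0 linhom_opp linhom_add.
Proof. by move=> f; apply: linear_ext => x /=; rewrite addNr. Qed.

HB.instance Definition _ := GRing.isZmodule.Build (linhom M N)
  linhom_addA linhom_addC linhom_add0 linhom_addN.
End Zmod.


Lemma linear_lift M N L (i : {linear M -> N}) (g : {linear L -> N}) :
  injective i -> (forall x, exists y, i y = g x) ->
  exists h : {linear L -> M}, forall x, i (h x) = g x.
Proof.
move=> inji /choice[h hE]; have lh : linear h.
  by move=> a x y; apply: inji; rewrite linearP !hE linearP.
by have [h' h'E] := linear_mk lh; exists h' => x; rewrite h'E hE.
Qed.

Lemma linear_factor M N L (p : {linear M -> N}) (g : {linear M -> L}) :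
  surj_map p -> (forall x, p x = 0 -> g x = 0) ->
  exists h : {linear N -> L}, forall x, h (p x) = g x.
Proof.
move=> /choice[t tE] gp.
have gE x y : p x = p y -> g x = g y.
  by move=> e; apply/subr0_eq; rewrite -linearB gp // linearB e subrr.
have lh : linear (g \o t).
  by move=> a x y /=; rewrite -linearP; apply: gE; rewrite linearP !tE.
by have [h hE] := linear_mk lh; exists h => x; rewrite hE /=; apply: gE.
Qed.

Lemma fin_gen_surj M N (p : {linear M -> N}) : surj_map p -> fin_gen M -> fin_gen N.
Proof.
move=> sp [n [g gE]]; exists n, (p \o g) => y; have [x <-] := sp y.
have [a ->] := gE x; exists a; rewrite linear_sum; apply: eq_bigr => j _ /=.
by rewrite linearZ.
Qed.

Lemma fin_gen_pair M N : fin_gen M -> fin_gen N -> fin_gen (M * N)%type.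
Proof.
move=> [m [g gE]] [n [h hE]].
exists (m + n)%N, (fun k => match split k with inl i => (g i, 0) | inr j => (0, h j) end).
move=> [x y]; have [a ->] := gE x; have [b ->] := hE y.
exists (fun k => match split k with inl i => a i | inr j => b j end).
rewrite big_split_ord /=.
rewrite (eq_bigr (fun i => (a i *: g i, 0))); last first.
  by move=> i _; rewrite (unsplitK (inl i)); congr pair; rewrite scaler0.
rewrite [X in _ + X](eq_bigr (fun i => (0, b i *: h i))); last first.
  by move=> i _; rewrite (unsplitK (inr i)); congr pair; rewrite scaler0.
have e1 (F : 'I_m -> M) : \sum_i (F i, 0 : N) = (\sum_i F i, 0).
  by apply: (big_rec2 (fun u v => v = (u, 0))) => // i ? ? _ ->; congr pair; rewrite addr0.
have e2 (F : 'I_n -> N) : \sum_i (0 : M, F i) = (0, \sum_i F i).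
  by apply: (big_rec2 (fun u v => v = (0, u))) => // i ? ? _ ->; congr pair; rewrite addr0.
by rewrite e1 e2; congr pair; rewrite ?addr0 ?add0r.
Qed.

Lemma fin_gen_regular : fin_gen (R^o : lmodType R).
Proof.
exists 1%N, (fun _ => 1) => x; exists (fun _ => x).
by rewrite big_ord1 /GRing.scale /= mulr1.
Qed.

Lemma fin_gen_zero : fin_gen ('rV[R]_0 : lmodType R).
Proof. by exists 0%N, (fun _ => 0) => x; exists (fun _ => 0); rewrite big_ord0 thinmx0. Qed.

Lemma orbit_map M (x : M) : exists f : {linear (R^o : lmodType R) -> M}, forall a, f a = a *: x.
Proof.
by apply: (@linear_mk (R^o : lmodType R) M (fun a => a *: x)) => a b c; rewrite scalerDl scalerA.
Qed.

(** * Submodules as modules *)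

Section Submodule.
Variables (M : lmodType R) (U : {pred M}).

(** The closure proof is an argument of the type, so that the module structure is inferred from
    it. *)
Definition submodule of submod_closed U := {x : M | x \in U}.
Variable hU : submod_closed U.
Local Notation S := (submodule hU).

HB.instance Definition _ := [isSub for (@proj1_sig _ _ : S -> M)].
HB.instance Definition _ := [Choice of S by <:].

Lemma submodD x y : x \in U -> y \in U -> x + y \in U.
Proof. by case: hU => _ h hx hy; have := h 1 _ _ hx hy; rewrite scale1r. Qed.
Lemma submodZ a x : x \in U -> a *: x \in U.
Proof. by case: hU => h0 h hx; have := h a _ _ hx h0; rewrite addr0. Qed.
Lemma submod0 : 0 \in U.
Proof. by case: hU. Qed.
Lemma submodN x : x \in U -> - x \in U.
Proof. by rewrite -scaleN1r; apply: submodZ. Qed.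

Definition sub_add (x y : S) : S := exist (fun x => x \in U) _ (submodD (svalP x) (svalP y)).
Definition sub_opp (x : S) : S := exist (fun x => x \in U) _ (submodN (svalP x)).
Definition sub_zero : S := exist (fun x => x \in U) _ submod0.
Definition sub_scale a (x : S) : S := exist (fun x => x \in U) _ (submodZ a (svalP x)).

Lemma sub_addA : associative sub_add.
Proof. by move=> x y z; apply: val_inj; rewrite /= addrA. Qed.
Lemma sub_addC : commutative sub_add.
Proof. by move=> x y; apply: val_inj; rewrite /= addrC. Qed.
Lemma sub_add0 : left_id sub_zero sub_add.
Proof. by move=> x; apply: val_inj; rewrite /= add0r. Qed.
Lemma sub_addN : left_inverse sub_zero sub_opp sub_add.
Proof. by move=> x; apply: val_inj; rewrite /= addNr. Qed.
HB.instance Definition _ := GRing.isZmodule.Build S sub_addA sub_addC sub_add0 sub_addN.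

Lemma sub_scaleA a b x : sub_scale a (sub_scale b x) = sub_scale (a * b) x.
Proof. by apply: val_inj; rewrite /= scalerA. Qed.
Lemma sub_scale1 : left_id 1 sub_scale.
Proof. by move=> x; apply: val_inj; rewrite /= scale1r. Qed.
Lemma sub_scaleDr : right_distributive sub_scale +%R.
Proof. by move=> a x y; apply: val_inj; rewrite /= scalerDr. Qed.
Lemma sub_scaleDl x : {morph sub_scale^~ x : a b / a + b}.
Proof. by move=> a b; apply: val_inj; rewrite /= scalerDl. Qed.
HB.instance Definition _ := GRing.Zmodule_isLmodule.Build R S
  sub_scaleA sub_scale1 sub_scaleDr sub_scaleDl.

Lemma submodule_incl : exists i : {linear S -> M},
  injective i /\ forall x, (exists y, i y = x) <-> x \in U.
Proof.
have [|i iE] := @linear_mk S M (@proj1_sig _ _); first by move=> a x y.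
exists i; split; first by move=> x y; rewrite !iE => e; apply: val_inj.
move=> x; split=> [[y <-]|hx]; first by rewrite iE; exact: (svalP y).
by exists (exist (fun x => x \in U) x hx); rewrite iE.
Qed.
End Submodule.

Lemma submodule_exists M (P : M -> Prop) :
  P 0 -> (forall a x y, P x -> P y -> P (a *: x + y)) ->
  exists (S : lmodType R) (i : {linear S -> M}),
    injective i /\ forall x, (exists y, i y = x) <-> P x.
Proof.
move=> P0 PD; pose U : {pred M} := [pred x | `[< P x >]].
have hU : submod_closed U.
  by split=> [|a x y /asboolP hx /asboolP hy]; apply/asboolP => //; apply: PD.
have [i [ii iU]] := submodule_incl hU.
exists (submodule hU), i; split=> // x; rewrite iU; split=> [/asboolP//|h].
exact/asboolP.
Qed.

Lemma linear_image M N (f : {linear M -> N}) :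
  exists (E : lmodType R) (q : {linear M -> E}) (m : {linear E -> N}),
    [/\ surj_map q, injective m & forall x, f x = m (q x)].
Proof.
have [||E [m [im mE]]] := @submodule_exists N (fun y => exists x, f x = y).
- by exists 0; rewrite linear0.
- by move=> a _ _ [x <-] [y <-]; exists (a *: x + y); rewrite linearP.
have [|q qE] := @linear_lift _ _ _ m f im; first by move=> x; apply/mE; exists x.
exists E, q, m; split=> // y; have [x xE] : exists x, f x = m y by apply/mE; exists y.
by exists x; apply: im; rewrite qE.
Qed.

Definition fgmod := {M : lmodType R | fin_gen M}.
Definition fgcomp (X Y Z : fgmod) (g : linhom (sval Y) (sval Z))
    (f : linhom (sval X) (sval Y)) : linhom (sval X) (sval Z) :=
  ((g : {linear _ -> _}) \o (f : {linear _ -> _})).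

(** Kept transparent, so that arrows are linear maps and compose as such by conversion. *)
Definition fgcat : precat.
Proof.
refine (@PreCat fgmod (fun X Y => linhom (sval X) (sval Y)) fgcomp
  (fun X => (idfun : {linear sval X -> sval X})) _ _ _ _ _).
- by move=> *; apply: linear_ext => x.
- by move=> *; apply: linear_ext => x.
- by move=> *; apply: linear_ext => x.
- by move=> *; apply: linear_ext => x.
- by move=> X Y Z f g h; apply: linear_ext => x /=; rewrite raddfD.
Defined.


End LinearMaps.
(** * Modules over a finite-dimensional algebra *)

Section Coordinates.
Variable K : fieldType.

(** While some [v] in the subspace lies outside the row space of [B], adjoining it raises the rank,
    which is at most [n]. *)
Lemma rowspace_exists n (P : 'rV[K]_n -> Prop) :
  P 0 -> (forall a u v, P u -> P v -> P (a *: u + v)) ->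
  exists B : 'M[K]_n, forall v, P v <-> (v <= B)%MS.
Proof.
move=> P0 PD.
suff gen k (B : 'M[K]_n) : (n - \rank B < k)%N -> (forall v, (v <= B)%MS -> P v) ->
    exists B : 'M[K]_n, forall v, P v <-> (v <= B)%MS.
  by apply: (gen n.+1 0); [rewrite ltnS leq_subr | move=> v; rewrite submx0 => /eqP->].
elim: k B => // k IHk B lB hB.
have [all|] := pselect (forall v, P v -> (v <= B)%MS); first by exists B => v; split=> [/all|/hB].
move=> /existsNP[v /not_implyP[Pv nv]]; apply: (IHk (B + v)%MS).
  have lt : (\rank B < \rank (B + v)%MS)%N.
    apply: rank_ltmx; rewrite ltmxE addsmxSl /=; apply/negP => h; apply: nv.
    exact: submx_trans (addsmxSr _ _) h.
  by rewrite ltnS in lB; apply: leq_trans lB; apply: ltn_sub2l (leq_trans lt (rank_leq_col _)) lt.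
move=> w /sub_addsmxP[[a b] /= ->].
rewrite [b]mx11_scalar mul_scalar_mx addrC.
by apply: PD => //; apply: hB; apply: submxMl.
Qed.

Section LinearRV.
Variables (m n : nat) (f : {linear 'rV[K]_m -> 'rV[K]_n}).

Lemma rV_injective_free : injective f -> row_free (lin1_mx f).
Proof.
move=> fi; apply: inj_row_free => v; rewrite mul_rV_lin1 => e.
by apply: fi; rewrite e linear0.
Qed.

Lemma rV_surj_full : surj_map f -> row_full (lin1_mx f).
Proof.
move=> fs; rewrite -sub1mx; apply/row_subP => i; have [v <-] := fs (row i 1%:M).
by rewrite -mul_rV_lin1 submxMl.
Qed.

Lemma rV_injective_leq : injective f -> (m <= n)%N.
Proof. by move/rV_injective_free/eqP=> <-; apply: rank_leq_col. Qed.

Lemma rV_surj_leq : surj_map f -> (n <= m)%N.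
Proof. by move/rV_surj_full/eqP=> <-; apply: rank_leq_row. Qed.

Lemma rV_injective_surj : m = n -> injective f -> surj_map f.
Proof.
move=> e /rV_injective_free h v.
have /submxP[w ->] : (v <= lin1_mx f)%MS.
  by apply: submx_full; rewrite /row_full -[X in _ == X]e.
by exists w; rewrite mul_rV_lin1.
Qed.

Lemma rV_surj_injective : m = n -> surj_map f -> injective f.
Proof.
move=> e /rV_surj_full h u v; rewrite -!mul_rV_lin1; apply: row_free_inj.
by rewrite /row_free [X in _ == X]e.
Qed.
End LinearRV.

End Coordinates.

Import VectorInternalTheory.

Section FiniteDimension.
Variables (K : fieldType) (A : falgType K).
Implicit Types M N L : lmodType A^c.

Definition inK (k : K) : A^c := (k%:A : A).

Lemma inK_mul k (a : A^c) : inK k * a = (k *: (a : A) : A).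
Proof. by rewrite /inK {1}/GRing.mul /= mulr_algr. Qed.

(** Restriction of scalars to [K]; the alias keeps the two scalar actions apart. *)
Definition res M : Type := M.
Section Res.
Variable M : lmodType A^c.
HB.instance Definition _ := GRing.Zmodule.on (res M).
Definition res_scale (k : K) (x : res M) : res M := inK k *: (x : M).
Lemma res_scaleA a b x : res_scale a (res_scale b x) = res_scale (a * b) x.
Proof. by rewrite /res_scale scalerA inK_mul /inK scalerA. Qed.
Lemma res_scale1 : left_id 1 res_scale.
Proof. by move=> x; rewrite /res_scale /inK scale1r; apply: (scale1r (x : M)). Qed.
Lemma res_scaleDr : right_distributive res_scale +%R.
Proof. by move=> a x y; apply: (scalerDr _ (x : M)). Qed.
Lemma res_scaleDl x : {morph res_scale^~ x : a b / a + b}.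
Proof. by move=> a b; rewrite /res_scale /inK scalerDl; apply: (scalerDl (x : M)). Qed.
HB.instance Definition _ := GRing.Zmodule_isLmodule.Build K (res M)
  res_scaleA res_scale1 res_scaleDr res_scaleDl.
End Res.

Lemma res_linear M N (f : {linear M -> N}) :
  exists g : {linear res M -> res N}, forall x, g x = f x.
Proof.
apply: (@linear_mk K (res M) (res N) f) => a x y.
exact: (linearP f (inK a) x y).
Qed.

(** The coefficients of [m] generators form an [m] by [dim A] matrix over [K]; conversely,
    generators over [K] also generate over the algebra. *)
Lemma fin_gen_dim M :
  fin_gen M <-> exists n (g : {linear 'rV[K]_n -> res M}), surj_map g.
Proof.
split=> [[m [g gE]]|[n [g gs]]].
  pose f (v : 'rV[K]_(m * dim A)) : res M :=
    \sum_i (r2v (row i (vec_mx v)) : A^c) *: g i.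
  have [|f' fE] := @linear_mk K 'rV_(m * dim A) (res M) f.
    move=> a u v; rewrite /f linearP scaler_sumr -big_split; apply: eq_bigr => i _ /=.
    rewrite !linearP /=; rewrite (scalerDl (g i)); congr (_ + _).
    by rewrite -inK_mul -scalerA.
  exists (m * dim A)%N, f' => x; have [a ->] := gE x.
  exists (mxvec (\matrix_i v2r (a i : A))); rewrite fE /f mxvecK.
  by apply: eq_bigr => i _; rewrite rowK v2rK.
exists n, (fun j => g (delta_mx 0 j)) => x; have [v <-] := gs x.
exists (fun j => inK (v 0 j)); rewrite {1}[v]row_sum_delta linear_sum.
by apply: eq_bigr => j _; rewrite linearZ.
Qed.

Lemma coordinates M : fin_gen M ->
  exists n (f : {linear res M -> 'rV[K]_n}), injective f /\ surj_map f.
Proof.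
move=> /fin_gen_dim[n [g gs]].
have [||B BE] := @rowspace_exists K n (fun v => g v = 0).
- exact: linear0.
- by move=> a u v gu gv; rewrite linearP gu gv scaler0 addr0.
(* Multiplication by [D] has kernel the row space of [B], that is the kernel of [g], and is onto
   since [D] has full column rank. *)
pose D := col_base (cokermx B).
have DE v : v *m D = 0 <-> g v = 0.
  have DB : v *m cokermx B = v *m D *m row_base (cokermx B) by rewrite -mulmxA mulmx_base.
  rewrite BE submxE DB.
  split=> [->|/eqP e]; first by rewrite mul0mx.
  by apply: (row_free_inj (row_base_free (cokermx B))); rewrite mul0mx.
have [|f fE] := linear_factor (g := mulmxr D) gs; first by move=> v /DE.
exists (\rank (cokermx B)), f; split=> [x y e|w].
  have [u ux] := gs x; have [v vy] := gs y.
  rewrite -ux -vy in e *; apply/subr0_eq; rewrite -linearB; apply/DE.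
  by rewrite mulmxBl -[u *m D]fE -[v *m D]fE e subrr.
have /submxP[v ->] : (w <= D)%MS by apply: submx_full; apply: col_base_full.
by exists (g v); rewrite fE.
Qed.

Lemma fin_gen_sub M N (i : {linear N -> M}) : injective i -> fin_gen M -> fin_gen N.
Proof.
move=> ii /coordinates[n [f [fi fs]]]; have [i' iE] := res_linear i.
have [||B BE] := @rowspace_exists K n (fun v => exists x, f (i' x) = v).
- by exists 0; rewrite !linear0.
- by move=> a _ _ [x <-] [y <-]; exists (a *: x + y); rewrite !linearP.
have fii : injective (f \o i') by move=> x y /fi; rewrite !iE => /ii.
have [|h hE] := @linear_lift K (res N) _ _ (f \o i') (mulmxr B) fii.
  by move=> v; apply/BE; apply: submxMl.
apply/fin_gen_dim; exists n, h => x.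
have /submxP[v vE] : (f (i' x) <= B)%MS by apply/BE; exists x.
by exists v; apply: fii; rewrite hE /= vE.
Qed.

(** Over a field a mono splits: the matrix [G] of [i] in coordinates is row free, and its
    pseudo-inverse gives a retraction. *)
Lemma linear_extension M N n (i : {linear M -> N}) (f : {linear res M -> 'rV[K]_n}) :
  fin_gen M -> fin_gen N -> injective i ->
  exists g : {linear res N -> 'rV[K]_n}, forall x, g (i x) = f x.
Proof.
move=> /coordinates[p [a [ai asj]]] /coordinates[q [b [bi bs]]] ii.
have [i' iE] := res_linear i.
have [|a' aE] := @linear_lift K (res M) _ _ a idfun ai; first exact: asj.
have inj_f : injective (b \o (i' \o a')).
  by move=> u v /bi /=; rewrite !iE => /ii e; rewrite -[u]aE -[v]aE /= e.
pose G := lin1_mx (b \o (i' \o a')).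
have GV : G *m pinvmx G = 1%:M by apply: mulmxVp; apply: rV_injective_free.
exists (f \o (a' \o (mulmxr (pinvmx G) \o b))) => x /=.
have e : b (i x) = a x *m G.
  rewrite mul_rV_lin1 /= -iE; congr (b (i' _)); apply: ai.
  by rewrite aE.
by rewrite e -mulmxA GV mulmx1; congr (f _); apply: ai; rewrite aE.
Qed.

(* The K-linear maps A -> K^n, in coordinates; a acts on a map by precomposition
   with the left multiplication by a. *)
Definition coind n := 'M[K]_(dim A, n).

Definition lmx (a : A^c) : 'M[K]_(dim A) :=
  \matrix_i v2r ((a : A) * r2v (delta_mx 0 i)).

Lemma lmxE a x : v2r x *m lmx a = v2r ((a : A) * x).
Proof.
rewrite mulmx_sum_row -{2}[x]v2rK {2}[v2r x]row_sum_delta linear_sum /=.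
rewrite mulr_sumr linear_sum; apply: eq_bigr => i _.
by rewrite rowK linearZ /= -scalerAr linearZ.
Qed.

Lemma v2r_ext n (B C : 'M[K]_(dim A, n)) :
  (forall x : A, v2r x *m B = v2r x *m C) -> B = C.
Proof.
move=> h; apply/row_matrixP => i; have := h (r2v (delta_mx 0 i)).
by rewrite r2vK -!rowE.
Qed.

Section Coinduced.
Variable n : nat.
HB.instance Definition _ := GRing.Zmodule.on (coind n).
Definition coind_scale (a : A^c) (B : coind n) : coind n := lmx a *m B.
Lemma coind_scaleA a b B : coind_scale a (coind_scale b B) = coind_scale (a * b) B.
Proof. by apply: v2r_ext => x; rewrite !mulmxA !lmxE mulrA. Qed.
Lemma coind_scale1 : left_id 1 coind_scale.
Proof. by move=> B; apply: v2r_ext => x; rewrite !mulmxA !lmxE mul1r. Qed.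
Lemma coind_scaleDr : right_distributive coind_scale +%R.
Proof. by move=> a B C; apply: mulmxDr. Qed.
Lemma coind_scaleDl B : {morph coind_scale^~ B : a b / a + b}.
Proof.
move=> a b; apply: v2r_ext => x.
by rewrite mulmxDr !mulmxA !lmxE mulrDl linearD mulmxDl.
Qed.
HB.instance Definition _ := GRing.Zmodule_isLmodule.Build A^c (coind n)
  coind_scaleA coind_scale1 coind_scaleDr coind_scaleDl.
End Coinduced.

Lemma coind_fin_gen n : fin_gen (coind n).
Proof.
apply/fin_gen_dim; exists (dim A * n)%N.
have [|g gE] := @linear_mk K 'rV[K]_(dim A * n) (res (coind n)) vec_mx.
  move=> a u v; rewrite linearP; congr (_ + _); apply: v2r_ext => x.
  by rewrite mulmxA lmxE mulr_algl -scalemxAr linearZ -scalemxAl.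
by exists g => x; exists (mxvec x); rewrite gE mxvecK.
Qed.

(** The coinduction adjunction: [y] is sent to the map taking [x] to [f (x *: y)]. *)
Lemma coind_map M n (f : {linear res M -> 'rV[K]_n}) :
  exists g : {linear M -> coind n}, forall (x : A) y,
    v2r x *m g y = f ((x : A^c) *: (y : M)).
Proof.
pose g (y : M) : coind n := \matrix_i f ((r2v (delta_mx 0 i) : A^c) *: y).
have gE (x : A) y : v2r x *m g y = f ((x : A^c) *: (y : M)).
  rewrite mulmx_sum_row -{2}[x]v2rK {2}[v2r x]row_sum_delta linear_sum /=.
  rewrite scaler_suml linear_sum; apply: eq_bigr => i _.
  by rewrite rowK linearZ /= -inK_mul -scalerA -linearZ.
have [|h hE] := @linear_mk A^c M (coind n) g.
  move=> a y z; apply: v2r_ext => x.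
  rewrite gE mulmxDr mulmxA lmxE !gE scalerDr linearD; congr (f _ + _).
  by rewrite scalerA.
by exists h => x y; rewrite hE gE.
Qed.

(** By the adjunction, extending [f] amounts to extending the [K]-linear map [ev], its evaluation at
    1. *)
Lemma coind_injective n : injective_module (coind n).
Proof.
move=> N L i f fN fL ii.
have [|ev evE] := @linear_mk K (res N) 'rV[K]_n (fun x => v2r (1 : A) *m f x).
  move=> a x y; rewrite (linearP f) mulmxDr; congr (_ + _).
  by rewrite mulmxA lmxE mulr1 linearZ -scalemxAl.
have [g gE] := linear_extension ev fN fL ii; have [h hE] := coind_map g.
exists h => x; apply: v2r_ext => y; rewrite hE -linearZ gE evE linearZ.
by rewrite mulmxA lmxE mulr1.
Qed.

(** Evaluation at 1 recovers the injective coordinate map. *)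
Lemma enough_injective M : fin_gen M ->
  exists n (f : {linear M -> coind n}), injective f.
Proof.
move=> /coordinates[n [f [fi _]]]; have [g gE] := coind_map f.
exists n, g => x y e; apply: fi.
by have := gE 1 x; rewrite e gE !scale1r.
Qed.

(** The quotient is realised inside [coind n], as the image of the map adjoint to the [K]-linear
    projection modulo the image of [f]. An element is killed when all its multiples lie in that
    image, hence when it does itself, the image being a submodule. *)
Lemma cokernel_exists M N (f : {linear M -> N}) : fin_gen N ->
  exists (Z : lmodType A^c) (q : {linear N -> Z}),
    surj_map q /\ forall y, q y = 0 <-> exists x, f x = y.
Proof.
move=> /coordinates[n [b [bi bs]]]; have [f' fE] := res_linear f.
have [||B BE] := @rowspace_exists K n (fun v => exists x, b (f' x) = v).
- by exists 0; rewrite !linear0.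
- by move=> a _ _ [x <-] [y <-]; exists (a *: x + y); rewrite !linearP.
have [g gE] := coind_map (mulmxr (cokermx B) \o b).
have [Z [q [m [qs mi gm]]]] := linear_image g.
exists Z, q; split=> // y; split=> [qy|[x <-]].
  have g0 : g y = 0 by rewrite gm qy linear0.
  have := gE 1 y; rewrite g0 mulmx0 scale1r /= => /esym/eqP.
  by rewrite -submxE => /BE[x /bi e]; exists x; rewrite -fE.
apply: mi; rewrite -gm linear0; apply: v2r_ext => a; rewrite gE mulmx0 /=.
by apply/eqP; rewrite -submxE; apply/BE; exists ((a : A^c) *: (x : M)); rewrite fE linearZ.
Qed.

End FiniteDimension.

(** * The category of finitely generated modules *)

Section ModuleCategory.
Variables (K : fieldType) (A : falgType K).
Notation C := (fgcat A^c).
Implicit Types X Y Z W M N : ob C.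

Definition car X : lmodType A^c := sval (X : fgmod A^c).
Definition obj (M : lmodType A^c) (fM : fin_gen M) : ob C := exist _ M fM.
Definition lmap X Y (f : @hom C X Y) : {linear car X -> car Y} := f.

Lemma car_fin_gen X : fin_gen (car X).
Proof. exact: (svalP (X : fgmod A^c)). Qed.

Lemma lmap_comp X Y Z (g : hom Y Z) (f : hom X Y) x : lmap (g ** f) x = lmap g (lmap f x).
Proof. by []. Qed.
Lemma lmap_idm X x : lmap (idm X) x = x.
Proof. by []. Qed.
Lemma lmap0 X Y x : lmap (0 : hom X Y) x = 0.
Proof. by []. Qed.
Lemma lmapD X Y (f g : hom X Y) x : lmap (f + g) x = lmap f x + lmap g x.
Proof. by []. Qed.
Lemma lmap_ext X Y (f g : hom X Y) : lmap f =1 lmap g -> f = g.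
Proof. exact: linear_ext. Qed.

(** Elements are tested by maps from the regular module: [x - y] is the image of 1. *)
Lemma lmap_mono X Y (f : hom X Y) : mono f <-> injective (lmap f).
Proof.
split=> [mf x y e|fi W g fg]; last first.
  apply: lmap_ext => w; apply: fi; rewrite -lmap_comp fg lmap0.
  by rewrite linear0.
have [o oE] := orbit_map (x - y).
pose o' : @hom C (obj (fin_gen_regular A^c)) X := o.
have o0 : o' = 0.
  apply: mf; apply: lmap_ext => a; rewrite lmap_comp lmap0 [lmap o' a]oE linearZ.
  by rewrite linearB e subrr /= scaler0.
by apply/subr0_eq; rewrite -(scale1r (x - y)) -oE -[o 1]/(lmap o' 1) o0.
Qed.

(** The projection to the cokernel is the test map. *)
Lemma lmap_epi X Y (f : hom X Y) : epi f <-> surj_map (lmap f).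
Proof.
split=> [ef y|fs W g gf]; last first.
  apply: lmap_ext => y; have [x <-] := fs y.
  by rewrite -lmap_comp gf !lmap0.
have [Z [q [qs qE]]] := cokernel_exists (lmap f) (car_fin_gen Y).
pose q' : @hom C Y (obj (fin_gen_surj qs (car_fin_gen Y))) := q.
have q0 : q' = 0 by apply: ef; apply: lmap_ext => x; apply/qE; exists x.
by apply/qE; rewrite -[q y]/(lmap q' y) q0.
Qed.

Lemma lmap_ses X Y Z (i : hom X Y) (p : hom Y Z) :
  ses i p <-> [/\ injective (lmap i), surj_map (lmap p) & exact_at (lmap i) (lmap p)].
Proof.
split=> [s|[ii ps ip]].
  split; [exact/lmap_mono/(ses_mono s) | exact/lmap_epi/(ses_epi s) |].
  move=> y; split=> [py|[x <-]]; last by rewrite -lmap_comp (ses_comp s).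
  have [o oE] := orbit_map y.
  pose o' : @hom C (obj (fin_gen_regular A^c)) Y := o.
  have [|h hE] := ses_ker s (g := o').
    by apply: lmap_ext => a; rewrite lmap_comp lmap0 [lmap o' a]oE linearZ py /= scaler0.
  by exists (lmap h 1); rewrite -lmap_comp -hE [lmap o' 1]oE scale1r.
split; [exact/lmap_mono | exact/lmap_epi | | |].
- by apply: lmap_ext => x; apply/ip; exists x.
- move=> W g pg; have [|h hE] := @linear_lift _ _ _ _ (lmap i) (lmap g) ii.
    by move=> w; apply/ip; rewrite -lmap_comp pg.
  by exists h; apply: lmap_ext => w; rewrite lmap_comp; apply/esym/hE.
- move=> W g gi; have [|h hE] := linear_factor (g := lmap g) ps.
    by move=> y /ip[x <-]; rewrite -lmap_comp gi.
  by exists h; apply: lmap_ext => y; rewrite lmap_comp; apply/esym/hE.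
Qed.

Lemma zero_moduleE X : zero_module (car X) <-> idm X = 0.
Proof.
split=> [z|z x]; first by apply: lmap_ext => x; rewrite (z x).
by rewrite -(lmap_idm x) z.
Qed.

Lemma biproduct_exists X Y : exists (S : ob C) (i1 : hom X S) (i2 : hom Y S) p1 p2,
  biproduct i1 i2 p1 p2.
Proof.
pose S := obj (fin_gen_pair (car_fin_gen X) (car_fin_gen Y)).
have [|i1 i1E] := @linear_mk _ (car X) (car S) (fun x => (x, 0)).
  by move=> a x y; congr pair => //=; rewrite scaler0 addr0.
have [|i2 i2E] := @linear_mk _ (car Y) (car S) (fun x => (0, x)).
  by move=> a x y; congr pair => //=; rewrite scaler0 addr0.
have [|p1 p1E] := @linear_mk _ (car S) (car X) fst; first by [].
have [|p2 p2E] := @linear_mk _ (car S) (car Y) snd; first by [].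
exists S, i1, i2, p1, p2; split; apply: lmap_ext => x.
- by rewrite lmap_comp [lmap p1 _]p1E [lmap i1 _]i1E.
- by rewrite lmap_comp [lmap p2 _]p2E [lmap i2 _]i2E.
- by rewrite lmap_comp [lmap p1 _]p1E [lmap i2 _]i2E.
- by rewrite lmap_comp [lmap p2 _]p2E [lmap i1 _]i1E.
- rewrite lmapD !lmap_comp [lmap i1 _]i1E [lmap i2 _]i2E [lmap p1 _]p1E [lmap p2 _]p2E.
  by case: x => x y; congr pair; rewrite ?addr0 ?add0r.
Qed.

Lemma iso_exists X Y (f : hom X Y) : injective (lmap f) -> surj_map (lmap f) ->
  exists g, g ** f = idm X /\ f ** g = idm Y.
Proof.
move=> fi fs; have [g gE] := @linear_lift _ _ _ _ (lmap f) idfun fi fs.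
exists g; split; apply: lmap_ext => x; last exact: gE.
by apply: fi; apply: gE.
Qed.

(** The length function is the dimension over [K]; between equal dimensions, injective and
    surjective coincide. *)
Lemma length_exists : exists len : ob C -> nat, forall X Y (f : hom X Y),
    (mono f -> (len X <= len Y)%N) /\ (epi f -> (len Y <= len X)%N) /\
    (len X = len Y -> mono f \/ epi f ->
       exists g, g ** f = idm X /\ f ** g = idm Y).
Proof.
have [len lenE] := choice (fun X => coordinates (car_fin_gen X)).
exists len => X Y f; have [a [ai asj]] := lenE X; have [b [bi bs]] := lenE Y.
have [f' fE] := res_linear (lmap f).
have [a' aE] := @linear_lift K _ _ _ a idfun ai asj.
pose h : {linear 'rV[K]_(len X) -> 'rV[K]_(len Y)} := b \o (f' \o a').
have hE x : h (a x) = b (lmap f x).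
  by rewrite /= -fE; congr (b (f' _)); apply: ai; rewrite aE.
have inj_h : injective (lmap f) <-> injective h.
  split=> [fi u v|hi x y e].
    by have [x <-] := asj u; have [y <-] := asj v; rewrite !hE => /bi/fi->.
  by apply/ai/hi; rewrite !hE e.
have surj_h : surj_map (lmap f) <-> surj_map h.
  split=> [fs v|hs y]; first by have [y <-] := bs v; have [x <-] := fs y; exists (a x).
  have [u hu] := hs (b y); have [x ux] := asj u.
  by exists x; apply: bi; rewrite -hE ux.
split; first by move/lmap_mono/inj_h/rV_injective_leq.
split; first by move/lmap_epi/surj_h/rV_surj_leq.
move=> e fme; apply: iso_exists.
  case: fme => [/lmap_mono//|/lmap_epi/surj_h hs]; apply/inj_h.
  exact: rV_surj_injective e hs.
case: fme => [/lmap_mono/inj_h hi|/lmap_epi//]; apply/surj_h.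
exact: rV_injective_surj e hi.
Qed.

Lemma abelian_fgcat : abelian C.
Proof.
split.
- exists (obj (fin_gen_zero A^c)); apply/zero_moduleE => x; exact: thinmx0.
- exact: biproduct_exists.
- move=> X Y i /lmap_mono ii.
  have [Z [q [qs qE]]] := cokernel_exists (lmap i) (car_fin_gen Y).
  pose q' : @hom C Y (obj (fin_gen_surj qs (car_fin_gen Y))) := q.
  by exists _, q'; apply/lmap_ses.
- move=> Y Z p /lmap_epi ps.
  have [||S [i [ii iE]]] := @submodule_exists _ (car Y) (fun y => lmap p y = 0).
  + exact: linear0.
  + by move=> a x y px py; rewrite linearP px py scaler0 addr0.
  pose i' : @hom C (obj (fin_gen_sub ii (car_fin_gen Y))) Y := i.
  by exists _, i'; apply/lmap_ses; split=> // y; split=> /iE.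
- move=> X Y f; have [E [q [m [qs mi fE]]]] := linear_image (lmap f).
  pose E' := obj (fin_gen_surj qs (car_fin_gen X)).
  exists E', (q : @hom C X E'), (m : @hom C E' Y); split.
  + exact/lmap_epi.
  + exact/lmap_mono.
  + by apply: lmap_ext => x; apply: fE.
- exact: length_exists.
Qed.

Lemma projE X : proj X <-> projective_module (car X).
Proof.
split=> [pX N L p f fN fL ps|pX N L p f /lmap_epi ps].
  have [g gE] := pX (obj fN) (obj fL) p f ((lmap_epi (X := obj fN) (Y := obj fL) p).2 ps).
  by exists g => x; rewrite -gE.
have [g gE] := pX _ _ (lmap p) (lmap f) (car_fin_gen N) (car_fin_gen L) ps.
by exists g; apply: lmap_ext.
Qed.

Lemma injE X : inj X <-> injective_module (car X).
Proof.
split=> [iX N L i f fN fL ii|iX N L i f /lmap_mono ii].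
  have [g gE] := iX (obj fL) (obj fN) i f ((lmap_mono (X := obj fN) (Y := obj fL) i).2 ii).
  by exists g => x; rewrite -gE.
have [g gE] := iX _ _ (lmap i) (lmap f) (car_fin_gen L) (car_fin_gen N) ii.
by exists g; apply: lmap_ext.
Qed.

Lemma enough_inj M : exists (J : ob C) (i : hom M J), inj J /\ mono i.
Proof.
have [n [f fi]] := enough_injective (car_fin_gen M).
pose J := obj (coind_fin_gen A n).
exists J, (f : @hom C M J); split; last exact/lmap_mono.
by apply/injE; apply: coind_injective.
Qed.

Definition regular : ob C := obj (fin_gen_regular A^c).

Lemma proj_regular : proj regular.
Proof.
move=> N L p f /lmap_epi ps; have [n nE] := ps (lmap f 1); have [o oE] := orbit_map n.
exists (o : @hom C regular N); apply: lmap_ext => a; rewrite lmap_comp [lmap _ a]oE.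
by rewrite linearZ nE -linearZ /=; congr (lmap f _); rewrite /GRing.scale /= mulr1.
Qed.

(** The cover is free of rank [m], built by extensions. The class [T] will be the projectives, and
    then the objects with [dd_ge d]. *)
Lemma free_cover (T : ob C -> Prop) : (forall Z, idm Z = 0 -> T Z) -> T regular ->
  (forall X Y Z, short X Y Z -> T X -> T Z -> T Y) ->
  forall M, exists F (p : hom F M), T F /\ epi p.
Proof.
move=> T0 T1 TD M; have [m [g gE]] := car_fin_gen M.
suff [F [p [TF pE]]] : exists F (p : @hom C F M), T F /\
    forall a, exists x, lmap p x = \sum_i a i *: g i.
  exists F, p; split=> //; apply/lmap_epi => y; have [a ->] := gE y; exact: pE.
elim: m g {gE} => [|m IHm] g.
  have [z z0] := ab_zero abelian_fgcat; exists z, 0; split; first exact: T0.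
  by move=> a; exists 0; rewrite big_ord0.
have [F [p [TF pE]]] := IHm (fun i => g (lift ord0 i)).
have [o oE] := orbit_map (g ord0); pose o' : @hom C regular M := o.
have [S [i1 [i2 [p1 [p2 b]]]]] := biproduct_exists regular F.
exists S, (o' ** p1 + p ** p2); split.
  by apply: TD T1 TF; exists i1, p2; apply: biproduct_ses b.
move=> a; have [x xE] := pE (fun i => a (lift ord0 i)).
have e1 : (o' ** p1 + p ** p2) ** i1 = o'.
  by rewrite compDl -!compA (bip11 b) (bip21 b) compm1 compm0 addr0.
have e2 : (o' ** p1 + p ** p2) ** i2 = p.
  by rewrite compDl -!compA (bip22 b) (bip12 b) compm1 compm0 add0r.
exists (lmap i1 (a ord0) + lmap i2 x).
by rewrite linearD -!lmap_comp e1 e2 [lmap o' _]oE xE big_ord_recl.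
Qed.

Lemma enough_proj M : exists (P : ob C) (p : hom P M), proj P /\ epi p.
Proof.
apply: (@free_cover (@proj C)) => [Z||]; [exact: zero_proj | exact: proj_regular |].
by move=> X Y Z s pX pZ; apply: short_proj_mid s.
Qed.

(** A projective is a summand of a free module. *)
Lemma dd_ge_proj d : dd_ge d regular -> forall P : ob C, proj P -> dd_ge d P.
Proof.
move=> hd P pP; have [||F [p [hF ep]]] := @free_cover (@dd_ge C d) _ hd _ P.
- move=> z z0; apply: dd_ge_projinj; first exact: abelian_fgcat.
  by split; [apply: zero_proj | apply: zero_inj].
- by move=> X Y Z s; apply: dd_ge_ext s; apply: abelian_fgcat.
have [N [i s]] := ab_epi abelian_fgcat ep.
have s1 : short N F P by exists i, p.
exact: (dd_ge_summand abelian_fgcat (short_proj_sym pP s1) s1 hF).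
Qed.

(** A nonzero [x - y] in the kernel of [g] would yield a nonzero [f t] killed by [g], although [g]
    is injective on the image of [m]. *)
Lemma essential_of X E Y (f : {linear car X -> car Y}) (q : hom X E) (m : hom E Y) :
  (forall x, f x = lmap m (lmap q x)) -> surj_map (lmap q) ->
  essential_image f -> essential m.
Proof.
move=> fE qs ef W g /lmap_mono gm; apply/lmap_mono => x y e.
apply/eqP/contraT => nxy; pose U : {pred car Y} := [pred z | lmap g z == 0].
have hU : submod_closed U.
  split=> [|a u v]; first by rewrite inE linear0.
  by rewrite !inE => /eqP hu /eqP hv; rewrite linearP hu hv scaler0 addr0.
have [|t] := ef U hU; first by exists (x - y); rewrite ?inE ?linearB ?subr_eq0 //; apply/eqP.
rewrite inE => /eqP ht /eqP[]; rewrite fE in ht *.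
have -> : lmap q t = 0 by apply: gm; rewrite lmap_comp ht linear0.
exact: linear0.
Qed.

(** If [U] met the image of [f] only in zero, the projection modulo [U] would be mono on [E], hence
    mono, and [U] would be zero. *)
Lemma essential_to X E Y (f : {linear car X -> car Y}) (q : hom X E) (m : hom E Y) :
  (forall x, f x = lmap m (lmap q x)) -> surj_map (lmap q) ->
  mono m -> essential m -> essential_image f.
Proof.
move=> fE qs mm em U hU [y Uy ny]; apply: contrapT => no.
have [j [ji jE]] := submodule_incl hU.
have [Z [r [rs rE]]] := cokernel_exists j (car_fin_gen Y).
pose r' : @hom C Y (obj (fin_gen_surj rs (car_fin_gen Y))) := r.
have rU z : r z = 0 <-> z \in U by rewrite rE jE.
suff /em/lmap_mono ri : mono (r' ** m).
  by case/eqP: ny; apply: ri; rewrite linear0; apply/rU.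
apply/lmap_mono; suff h e : lmap (r' ** m) e = 0 -> e = 0.
  by move=> u v e; apply/subr0_eq/h; rewrite linearB e subrr.
have [x <-] := qs e; rewrite lmap_comp -fE => /rU Ux.
case: (eqVneq (f x) 0) => [f0|nf]; last by case: no; exists x.
by move/lmap_mono: mm => mi; apply: mi; rewrite -fE f0 linear0.
Qed.

(** As [q ** g] is onto, the image of [g] and the kernel of [f] together span [X]. *)
Lemma superfluous_of X E Y (f : {linear car X -> car Y}) (q : hom X E) (m : hom E Y) :
  (forall x, f x = lmap m (lmap q x)) -> mono m ->
  superfluous_kernel f -> @essential (opcat C) E X q.
Proof.
move=> fE /lmap_mono mi ef W g /lmap_epi qg; apply/lmap_epi.
pose U : {pred car X} := [pred z | `[< exists w, lmap g w = z >]].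
have hU : submod_closed U.
  split=> [|a u v]; first by apply/asboolP; exists 0; rewrite linear0.
  move=> /asboolP[x <-] /asboolP[y <-]; apply/asboolP; exists (a *: x + y).
  by rewrite linearP.
have full : forall x, x \in U.
  apply: ef hU _ => x; have [w wE] := qg (lmap q x).
  exists (lmap g w), (x - lmap g w); split; first by apply/asboolP; exists w.
  - by rewrite linearB !fE -(lmap_comp q) wE subrr.
  - by rewrite addrC subrK.
by move=> x; apply/asboolP; exact: full.
Qed.

(** Modulo the kernel of [f], which [q] kills, [U] is everything; so its inclusion followed by [q]
    is onto. *)
Lemma superfluous_to X E Y (f : {linear car X -> car Y}) (q : hom X E) (m : hom E Y) :
  (forall x, f x = lmap m (lmap q x)) -> mono m -> epi q ->
  @essential (opcat C) E X q -> superfluous_kernel f.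
Proof.
move=> fE /lmap_mono mi /lmap_epi qs eq U hU h x.
have [j [ji jE]] := submodule_incl hU.
pose j' : @hom C (obj (fin_gen_sub ji (car_fin_gen X))) X := j.
have : epi j'.
  apply: eq; apply/lmap_epi => e; have [y <-] := qs e.
  have [u [k [Uu fk ->]]] := h y; have /jE[s sE] := Uu.
  exists s; rewrite lmap_comp [lmap j' s]sE linearD.
  have -> : lmap q k = 0 by apply: mi; rewrite -fE fk linear0.
  by rewrite addr0.
by move/lmap_epi/(_ x) => /jE.
Qed.

End ModuleCategory.
(** * Resolutions and values of the dimensions *)

Lemma leastP (P : nat -> Prop) n :
  least P = n%:Z%:E <-> P n /\ forall k, (k < n)%N -> ~ P k.
Proof.
rewrite /least; case: pselect => [ex|nex]; last first.
  by split=> // -[Pn _]; case: nex; exists n; apply/asboolP.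
case: ex_minnP => m /asboolP Pm hm; split=> [[<-]|[Pn hn]].
  by split=> // k lk /asboolP/hm; rewrite leqNgt lk.
congr (_%:E); congr Posz; apply/eqP; rewrite eqn_leq hm; last exact/asboolP.
by rewrite leqNgt; apply/negP => /hn.
Qed.

Lemma least_attained (P : nat -> Prop) n : P n ->
  exists m, [/\ (m <= n)%N, least P = m%:Z%:E, P m & forall k, (k < m)%N -> ~ P k].
Proof.
move=> Pn; have ex : exists m, `[< P m >] by exists n; apply/asboolP.
case: (ex_minnP ex) => m /asboolP Pm hm; exists m.
have hk k : (k < m)%N -> ~ P k by move=> lk /asboolP/hm; rewrite leqNgt lk.
by split=> //; [apply/hm/asboolP | apply/leastP].
Qed.

Lemma least_le (P : nat -> Prop) n : (least P <= n%:Z%:E)%E -> exists2 m, (m <= n)%N & P m.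
Proof.
rewrite /least; case: pselect => // ex.
by case: ex_minnP => m /asboolP Pm _; exists m.
Qed.

Section Resolutions.
Variables (K : fieldType) (A : falgType K).
Notation C := (fgcat A^c).
Notation abC := (abelian_fgcat A).
Implicit Types M : ob C.

Lemma image_choice (X Y : nat -> ob C) (d : forall n, hom (X n) (Y n)) :
  exists (E : nat -> ob C) (q : forall n, hom (X n) (E n)) (m : forall n, hom (E n) (Y n)),
    forall n, [/\ epi (q n), mono (m n) & d n = m n ** q n].
Proof.
pose E n := cid (ab_image abC (d n)); pose q n := cid (projT2 (E n)).
pose m n := cid (projT2 (q n)).
exists (fun n => projT1 (E n)), (fun n => projT1 (q n)), (fun n => projT1 (m n)).
by move=> n; exact: (projT2 (m n)).
Qed.

(** The long sequence is cut at the images of its differentials, with [Z 0 = M]. *)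
Lemma coresolution_ses M (Q : coaugmented (car M)) : injective_coresolution Q ->
  exists (fI : forall n, fin_gen (cterm Q n)) (Z : nat -> ob C)
      (i : forall n, hom (Z n) (obj (fI n))) (p : forall n, hom (obj (fI n)) (Z n.+1)),
    [/\ Z 0 = M, forall n, ses (i n) (p n), forall n, inj (obj (fI n))
      & minimal_injective_coresolution Q -> forall n, essential (i n)].
Proof.
move=> [hI ai e0 eS]; pose fI n := (hI n).1; pose I n := obj (fI n).
pose d n : @hom C (I n) (I n.+1) := cdiff Q n.
have [E [q [m qm]]] := image_choice d.
pose Z n : ob C := if n is k.+1 then E k else M.
pose i n : hom (Z n) (I n) := if n is k.+1 then m k else caug Q : @hom C M (I 0).
pose p n : hom (I n) (Z n.+1) := q n.
have dE n y : cdiff Q n y = lmap (m n) (lmap (q n) y).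
  by have [_ _ e] := qm n; rewrite -lmap_comp -e.
have q0 n y : lmap (q n) y = 0 <-> cdiff Q n y = 0.
  have [_ /lmap_mono mi _] := qm n; rewrite dE; split=> [->|e]; first exact: linear0.
  by apply: mi; rewrite e linear0.
exists fI, Z, i, p; split=> //.
- move=> n; have [eq _ _] := qm n; apply/lmap_ses; split; last 2 first.
  + exact/lmap_epi.
  + case: n eq => [|n] eq y; first by rewrite [lmap (p 0) y = 0]q0; apply: e0.
    rewrite [lmap (p n.+1) y = 0]q0 eS; have [/lmap_epi qs _ _] := qm n.
    split=> [[x <-]|[x xE]]; first by exists (lmap (q n) x); rewrite -dE.
    by have [z zE] := qs x; exists z; rewrite dE zE.
  + by case: n {eq} => [|n]; [exact: ai | have [_ /lmap_mono] := qm n].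
- by move=> n; apply/injE; apply: (hI n).2.
- move=> [_ ea ed] [|n].
    apply: (@essential_of _ _ M (Z 0) (I 0) (caug Q) (idm M) (i 0)) => //.
    by apply/lmap_epi; apply: epi_id.
  have [/lmap_epi qs _ _] := qm n.
  exact: (@essential_of _ _ (I n) _ (I n.+1) (cdiff Q n) (q n) (m n) (dE n) qs (ed n)).
Qed.

Lemma resolution_ses M (Q : augmented (car M)) : projective_resolution Q ->
  exists (fP : forall n, fin_gen (aterm Q n)) (Z : nat -> ob C)
      (i : forall n, hom (obj (fP n)) (Z n)) (p : forall n, hom (Z n.+1) (obj (fP n))),
    [/\ Z 0 = M, forall n, ses (p n) (i n), forall n, proj (obj (fP n))
      & minimal_projective_resolution Q -> forall n, @essential (opcat C) (Z n) _ (i n)].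
Proof.
move=> [hP as_ e0 eS]; pose fP n := (hP n).1; pose P n := obj (fP n).
pose d n : @hom C (P n.+1) (P n) := adiff Q n.
have [E [q [m qm]]] := image_choice d.
pose Z n : ob C := if n is k.+1 then E k else M.
pose i n : hom (P n) (Z n) := if n is k.+1 then q k else aaug Q : @hom C (P 0) M.
pose p n : hom (Z n.+1) (P n) := m n.
have dE n y : adiff Q n y = lmap (m n) (lmap (q n) y).
  by have [_ _ e] := qm n; rewrite -lmap_comp -e.
have q0 n y : lmap (q n) y = 0 <-> adiff Q n y = 0.
  have [_ /lmap_mono mi _] := qm n; rewrite dE; split=> [->|e]; first exact: linear0.
  by apply: mi; rewrite e linear0.
have mE n y : (exists x, lmap (p n) x = y) <-> exists x, adiff Q n x = y.
  have [/lmap_epi qs _ _] := qm n; split=> -[x <-].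
    by have [z <-] := qs x; exists z; rewrite dE.
  by exists (lmap (q n) x); rewrite dE.
exists fP, Z, i, p; split=> //.
- move=> n; have [_ mm _] := qm n; apply/lmap_ses; split; first exact/lmap_mono.
  + by case: n {mm} => [|n]; [exact: as_ | have [/lmap_epi] := qm n].
  + case: n {mm} => [|n] y; rewrite mE; first exact: e0.
    by rewrite [lmap (i n.+1) y = 0]q0; apply: eS.
- by move=> n; apply/projE; apply: (hP n).2.
- move=> [_ ea ed] [|n].
    by apply: (@superfluous_of _ _ (P 0) (Z 0) M (aaug Q) (i 0) (idm M)) => //; apply: mono_id.
  have [_ mm _] := qm n.
  exact: (@superfluous_of _ _ (P n.+1) _ (P n) (adiff Q n) (q n) (m n) (dE n) mm (ed n)).
Qed.

(** Splicing: a differential is the projection onto [Z n.+1] followed by its inclusion. *)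
Lemma ses_coresolution (I Z : nat -> ob C) (i : forall n, hom (Z n) (I n))
    (p : forall n, hom (I n) (Z n.+1)) :
  (forall n, ses (i n) (p n)) -> (forall n, inj (I n)) ->
  exists Q : coaugmented (car (Z 0)),
    [/\ forall n, cterm Q n = car (I n), injective_coresolution Q
      & (forall n, essential (i n)) -> minimal_injective_coresolution Q].
Proof.
move=> s iI; pose Q := @Coaugmented _ (car (Z 0)) (fun n => car (I n)) (lmap (i 0))
  (fun n => lmap (i n.+1 ** p n)).
have m0 n y : lmap (i n.+1) y = 0 -> y = 0.
  have /lmap_ses[ii _ _] := s n.+1.
  by move=> e; apply: ii; rewrite e linear0.
have rQ : injective_coresolution Q.
  split=> [n||y|n y].
  - by split; [apply: car_fin_gen | apply/injE].
  - by have /lmap_ses[] := s 0.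
  - have /lmap_ses[_ _ ex] := s 0; rewrite -ex -[cdiff Q 0 y]/(lmap (i 1) (lmap (p 0) y)).
    by split=> [/m0|->//]; rewrite ?linear0.
  - rewrite -[cdiff Q n.+1 y]/(lmap (i n.+2) (lmap (p n.+1) y)).
    have /lmap_ses[_ _ ex] := s n.+1; have /lmap_ses[_ ps _] := s n.
    split=> [/m0/ex[x <-]|[x <-]]; first by have [z <-] := ps x; exists z.
    have -> : lmap (p n.+1) (lmap (i n.+1 ** p n) x) = 0 by apply/ex; exists (lmap (p n) x).
    exact: linear0.
exists Q; split=> // ei; split=> // [|n].
  apply: (@essential_to _ _ (Z 0) _ (I 0) (caug Q) (idm (Z 0)) (i 0)) => //.
  - by apply/lmap_epi; apply: epi_id.
  - exact: ses_mono (s 0).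
apply: (@essential_to _ _ (I n) _ (I n.+1) (cdiff Q n) (p n) (i n.+1)) => //.
- by have /lmap_ses[] := s n.
- exact: ses_mono (s n.+1).
Qed.

Lemma ses_resolution (P Z : nat -> ob C) (i : forall n, hom (P n) (Z n))
    (p : forall n, hom (Z n.+1) (P n)) :
  (forall n, ses (p n) (i n)) -> (forall n, proj (P n)) ->
  exists Q : augmented (car (Z 0)),
    [/\ forall n, aterm Q n = car (P n), projective_resolution Q
      & (forall n, @essential (opcat C) (Z n) (P n) (i n)) -> minimal_projective_resolution Q].
Proof.
move=> s pP; pose Q := @Augmented _ (car (Z 0)) (fun n => car (P n)) (lmap (i 0))
  (fun n => lmap (p n ** i n.+1)).
have exE n y : lmap (i n) y = 0 <-> exists x, lmap (p n ** i n.+1) x = y.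
  have /lmap_ses[_ _ ex] := s n; have /lmap_ses[_ is_ _] := s n.+1; rewrite ex.
  split=> [[x <-]|[x <-]]; last by exists (lmap (i n.+1) x).
  by have [z <-] := is_ x; exists z.
have rQ : projective_resolution Q.
  split=> [n||y|n y] //.
  - by split; [apply: car_fin_gen | apply/projE].
  - by have /lmap_ses[] := s 0.
  - rewrite -exE -[adiff Q n y]/(lmap (p n) (lmap (i n.+1) y)); have /lmap_ses[pi _ _] := s n.
    by split=> [e|->]; [apply: pi; rewrite e linear0 | apply: linear0].
exists Q; split=> // ei; split=> // [|n].
  by apply: (@superfluous_to _ _ (P 0) _ (Z 0) (aaug Q) (i 0) (idm (Z 0))) => //;
    [apply: mono_id | apply: ses_epi (s 0)].
apply: (@superfluous_to _ _ (P n.+1) _ (P n) (adiff Q n) (i n.+1) (p n)) => //.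
- exact: ses_mono (s n).
- exact: ses_epi (s n.+1).
Qed.

Lemma idimE M : idim (car M) = least (fun n => id_le n M).
Proof.
congr least; apply/funext => n; apply/propext.
split=> [[Q [rQ zQ]]|/(id_coresolution abC)[I [Z [i [p [<- s iI hI]]]]]].
  have [fI [Z [i [p [ZM s iI _]]]]] := coresolution_ses rQ; rewrite -ZM.
  by apply: (coresolution_id s iI) => m lm; apply/zero_moduleE/zQ.
have [Q [tQ rQ _]] := ses_coresolution s iI; exists Q; split=> // k lk.
by rewrite tQ; apply/zero_moduleE/hI.
Qed.

Lemma pdimE M : pdim (car M) = least (fun n => pd_le n M).
Proof.
congr least; apply/funext => n; apply/propext.
split=> [[Q [rQ zQ]]|h].
  have [fP [Z [i [p [ZM s pP _]]]]] := resolution_ses rQ; rewrite -ZM.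
  apply/id_le_op; apply: (@coresolution_id (opcat C) _ Z i p (fun n => ses_op (s n)) pP) => m lm.
  exact/zero_moduleE/zQ.
(* A projective resolution is an injective coresolution in the opposite category. *)
have [P [Z [i [p [<- s pP hP]]]]] :=
  @id_coresolution (opcat C) (abelian_op abC) n M ((id_le_op n M).2 h).
have [Q [tQ rQ _]] := ses_resolution (fun n => op_ses (s n)) pP.
by exists Q; split=> // k lk; rewrite tQ; apply/zero_moduleE/hP.
Qed.

(** One minimal coresolution must have a non-projective term at [n], while below [n] every minimal
    coresolution has projective terms. *)
Lemma domdimE n M : dd_ge n M -> ~ dd_ge n.+1 M -> domdim (car M) = n%:Z%:E.
Proof.
move=> h1 h2; apply/leastP; split=> [|k lk [Q [mQ nQ]]].
  have [I [Z [i [p [ZM s iI ei]]]]] := minimal_coresolution abC (@enough_inj _ A) M.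
  subst M; have [Q [tQ _ mQ]] := ses_coresolution s iI; exists Q; split; first exact: mQ.
  rewrite tQ => /projE; exact: (minimal_coresolution_dd abC s iI ei h1 h2).2.
have [rQ _ _] := mQ; have [fI [Z [i [p [ZM s iI /(_ mQ) ei]]]]] := coresolution_ses rQ.
rewrite -ZM in h1 h2; apply: nQ.
by have /projE := (minimal_coresolution_dd abC s iI ei h1 h2).1 k lk.
Qed.

Lemma codomdimE n M : cd_ge n M -> ~ cd_ge n.+1 M -> codomdim (car M) = n%:Z%:E.
Proof.
move=> h1 h2; have abO := abelian_op abC.
apply/leastP; split=> [|k lk [Q [mQ nQ]]].
  have [P [Z [i [p [ZM s pP ei]]]]] := minimal_coresolution abO (@enough_proj _ A) M.
  subst M; have [Q [tQ _ mQ]] := ses_resolution (fun n => op_ses (s n)) pP.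
  exists Q; split; first exact: mQ.
  rewrite tQ => /injE; exact: (minimal_coresolution_dd abO s pP ei h1 h2).2.
have [rQ _ _] := mQ; have [fP [Z [i [p [ZM s pP /(_ mQ) ei]]]]] := resolution_ses rQ.
rewrite -ZM in h1 h2; apply: nQ.
have sO n' := ses_op (s n').
by have /injE := (minimal_coresolution_dd abO sO pP ei h1 h2).1 k lk.
Qed.

Lemma domdim_ge n M : domdim (car M) = n%:Z%:E -> dd_ge n M.
Proof.
move=> /leastP[[Q [mQ nQ]] hQ]; have [rQ _ _] := mQ.
have [fI [Z [i [p [ZM s iI _]]]]] := coresolution_ses rQ.
rewrite -ZM; apply: (coresolution_dd s iI) => m lm; apply: contrapT => nP.
by apply: (hQ m lm); exists Q; split=> // pm; apply: nP; apply/projE.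
Qed.

End Resolutions.
(** * Semisimple algebras *)

Section Semisimple.
Variable R : nzRingType.
Implicit Types M N L : lmodType R.

Lemma linear_graph M N (G : M -> N -> Prop) :
  (forall x, exists y, G x y) -> (forall y, G 0 y -> y = 0) ->
  (forall a x x' y y', G x y -> G x' y' -> G (a *: x + x') (a *: y + y')) ->
  exists f : {linear M -> N}, forall x, G x (f x).
Proof.
move=> /choice[f fG] G0 GP; have [|g gE] := @linear_mk _ M N f; last first.
  by exists g => x; rewrite gE.
have uniq x y y' : G x y -> G x y' -> y = y'.
  move=> h h'; apply/subr0_eq/G0; have := GP (-1) _ _ _ _ h' h.
  by rewrite !scaleN1r addNr addrC.
by move=> a x y; apply: uniq (fG _) _; apply: GP.
Qed.

Definition submod_pred M (W : M -> Prop) :=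
  W 0 /\ forall a x y, W x -> W y -> W (a *: x + y).

(** * Complements in sums of simple modules *)

Section Complement.
Variables (M : lmodType R) (U : M -> Prop).
Hypothesis subU : submod_pred U.

Definition in_sum (W : M -> Prop) x := exists u w, [/\ U u, W w & x = u + w].

Lemma in_sum_submod W : submod_pred W -> submod_pred (in_sum W).
Proof.
case: subU => U0 UP [W0 WP]; split; first by exists 0, 0; rewrite addr0.
move=> a _ _ [u [w [hu hw ->]]] [u' [w' [hu' hw' ->]]].
exists (a *: u + u'), (a *: w + w'); split; [exact: UP | exact: WP |].
by rewrite scalerDr addrACA.
Qed.

(** The preimage of [U + W] in the simple module [S] is zero or everything. If zero, the image of
    [S] joins [W] without creating an intersection with [U]; otherwise [W] is kept. *)
Lemma complement_step (S : lmodType R) (h : {linear S -> M}) W :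
  simple_module S -> submod_pred W -> (forall x, U x -> W x -> x = 0) ->
  exists W', [/\ submod_pred W', forall x, U x -> W' x -> x = 0,
    forall x, W x -> W' x & forall s, in_sum W' (h s)].
Proof.
move=> [_ simS] sW UW; have [s0 sP] := in_sum_submod sW.
pose V : {pred S} := [pred s | `[< in_sum W (h s) >]].
have [|V0|VT] := simS V; last first.
- by exists W; split=> // s; apply/asboolP; apply: VT.
- have [W0 WP] := sW; have [U0 UP] := subU.
  exists (fun x => exists w s, W w /\ x = w + h s); split.
  + split; first by exists 0, 0; rewrite linear0 addr0.
    move=> a _ _ [w [s [hw ->]]] [w' [s' [hw' ->]]].
    exists (a *: w + w'), (a *: s + s'); split; first exact: WP.
    by rewrite linearP scalerDr addrACA.
  + move=> x hU [w [s [hw e]]]; subst x.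
    suff s_0 : s = 0 by move: hU; rewrite s_0 linear0 addr0 => hU; apply: UW.
    apply: V0; apply/asboolP; exists (w + h s), (- w); split=> //.
      by rewrite -scaleN1r -[X in W X]addr0; apply: WP.
    by rewrite addrAC subrr add0r.
  + by move=> w hw; exists w, 0; rewrite linear0 addr0.
  + by move=> s; exists 0, (h s); split; rewrite ?add0r //; exists 0, s; rewrite add0r.
split=> [|a x y]; first by apply/asboolP; rewrite linear0.
by move=> /asboolP hx /asboolP hy; apply/asboolP; rewrite linearP; apply: sP.
Qed.

Lemma complement_exists (I : finType) (S : I -> lmodType R)
    (h : forall i, {linear S i -> M}) :
  (forall i, simple_module (S i)) ->
  (forall x, exists s : forall i, S i, x = \sum_i h i (s i)) ->
  exists W, [/\ submod_pred W, forall x, U x -> W x -> x = 0 & forall x, in_sum W x].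
Proof.
move=> simS span.
suff [W [sW UW hW]] : exists W, [/\ submod_pred W, forall x, U x -> W x -> x = 0
    & forall i, i \in enum I -> forall s, in_sum W (h i s)].
  exists W; split=> // x; have [s ->] := span x; have [s0 sP] := in_sum_submod sW.
  apply: (big_ind (in_sum W)) => // [y z hy hz|i _]; last by apply: hW; rewrite mem_enum.
  by rewrite -[y]scale1r; apply: sP.
elim: (enum I) => [|i r [W [sW UW hW]]].
  exists (fun x => x = 0); split=> //; split=> // a x y -> ->.
  by rewrite scaler0 addr0.
have [W' [sW' UW' WW' hi]] := complement_step (h i) (simS i) sW UW.
exists W'; split=> // j; rewrite inE => /predU1P[-> //|jr] s.
by have [u [w [hu hw ->]]] := hW j jr s; exists u, w; split=> //; apply: WW'.
Qed.
End Complement.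

Hypothesis ssR : semisimple_module (R^o : lmodType R).

(** Each generator is the image of 1 under a map from [R], so [M] is spanned by images of the simple
    summands of [R], indexed by pairs. *)
Lemma semisimple_complement M (U : M -> Prop) : fin_gen M -> submod_pred U ->
  exists W, [/\ submod_pred W, forall x, U x -> W x -> x = 0 & forall x, in_sum U W x].
Proof.
move=> [m [g gE]] sU; have [n [S [f [simS [f' _ fK]]]]] := ssR.
have [o oE] := choice (fun j => orbit_map (g j)).
apply: (complement_exists sU (I := ('I_m * 'I_n)%type) (S := fun i => S i.2)
  (h := fun i => o i.1 \o f i.2)) => [i|x]; first exact: simS.
have [a ->] := gE x; exists (fun i => f' (a i.1) i.2).
rewrite -(pair_bigA _ (fun j i => (o j \o f i) (f' (a j) i))).
apply: eq_bigr => j _ /=; rewrite -linear_sum fK oE //.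
Qed.

(** A complement of the kernel of [p] maps bijectively to [L]; the inverse is a section. *)
Lemma semisimple_projective (P : lmodType R) : projective_module P.
Proof.
move=> N L p f fN fL ps.
have [|W [[W0 WP] UW sumW]] := @semisimple_complement N (fun x => p x = 0) fN.
  split=> [|a x y hx hy]; first exact: linear0.
  by rewrite linearP hx hy scaler0 addr0.
have [|||t tE] := @linear_graph L N (fun y w => W w /\ p w = y).
- move=> y; have [x <-] := ps y; have [u [w [hu hw ->]]] := sumW x.
  by exists w; rewrite linearD hu add0r.
- by move=> w [hw pw]; apply: UW.
- by move=> a x x' w w' [hw <-] [hw' <-]; rewrite linearP; split=> //; apply: WP.
by exists (t \o f) => x; apply: (tE _).2.
Qed.

(** A complement of the image of [i] provides a retraction of [L] onto [N]. *)
Lemma semisimple_injective (I : lmodType R) : injective_module I.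
Proof.
move=> N L i f fN fL ii.
have [|W [[W0 WP] UW sumW]] := @semisimple_complement L (fun y => exists x, i x = y) fL.
  split=> [|a _ _ [x <-] [y <-]]; first by exists 0; rewrite linear0.
  by exists (a *: x + y); rewrite linearP.
have WN w : W w -> W (- w) by move=> hw; rewrite -scaleN1r -[X in W X]addr0; apply: WP.
have ret0 n w : W w -> i n + w = 0 -> n = 0.
  move=> hw e; apply: ii; rewrite linear0; apply: UW; first by exists n.
  by have -> : i n = - w; [apply/eqP; rewrite -addr_eq0 e | apply: WN].
have [|||r rE] := @linear_graph L N (fun y n => exists w, W w /\ y = i n + w).
- by move=> y; have [_ [w [[x <-] hw ->]]] := sumW y; exists x, w.
- by move=> n [w [hw e]]; apply: ret0 hw (esym e).
- move=> a _ _ n n' [w [hw ->]] [w' [hw' ->]]; exists (a *: w + w').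
  by split; [apply: WP | rewrite linearP scalerDr addrACA].
exists (f \o r) => x /=; congr (f _); have [w [hw e]] := rE (i x).
apply/esym/subr0_eq; apply: (ret0 _ (- w)); first exact: WN.
by rewrite linearB {1}e [_ + w]addrC addrK subrr.
Qed.

End Semisimple.

(** * The two dimension formulas *)

Theorem corollary3p9 (K : fieldType) (A : falgType K) (d : nat) (M : lmodType A^c) :
  connected_algebra A -> higher_auslander_algebra A -> gldim A^c = d%:Z%:E ->
  fin_gen M -> ~ (projective_module M /\ injective_module M) ->
  (pdim M + domdim M = gldim A^c)%E /\ (idim M + codomdim M = gldim A^c)%E.
Proof.
move=> _ [[dom _ _]|ss] gl fM nM; last first.
  (* Over a semisimple algebra every module is projective-injective, which contradicts [nM]. *)
  case: nM; split; first exact: semisimple_projective.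
  exact: semisimple_injective.
have abC := abelian_fgcat A; have abO := abelian_op abC.
have pd_bound X : @pd_le (fgcat A^c) d X.
  have /leastP[/(_ _ (car_fin_gen X)) + _] := gl.
  by rewrite pdimE => /least_le[m lmd]; apply: pd_le_leq.
have dd_proj : forall P : ob (fgcat A^c), proj P -> dd_ge d P.
  by apply: dd_ge_proj; apply: domdim_ge; rewrite -gl dom.
have id_bnd := id_bound abC pd_bound (@enough_inj _ A).
have cd_bnd := cd_inj abC dd_proj (@enough_proj _ A).
pose X := obj fM.
have nX : ~ projinj X by move=> [/projE ? /injE ?]; apply: nM.
have nX' : ~ @projinj (opcat (fgcat A^c)) X by move=> [? ?]; apply: nX.
have sumE p : (p <= d)%N -> (p%:Z%:E + (d - p)%N%:Z%:E = d%:Z%:E)%E.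
  by move=> lpd; rewrite -EFinD -PoszD subnKC.
rewrite gl -[M]/(car X) pdimE idimE; split.
  have [p [lpd -> pdX minp]] := least_attained (P := fun n => pd_le n X) (pd_bound X).
  rewrite (domdimE (dd_ge_pd abC dd_proj lpd pdX)) ?sumE //.
  exact: (dd_lt abC pd_bound nX lpd pdX minp).
(* The same two lemmas, now in the opposite category, where the dual bounds play the part of the
   original ones. *)
have [q [lqd -> idX minq]] := least_attained (P := fun n => id_le n X) (id_bnd X).
rewrite (codomdimE (dd_ge_pd abO cd_bnd lqd idX)) ?sumE //.
exact: (dd_lt abO id_bnd nX' lqd idX minq).
Qed.
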